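(* Let $n\ge2$, $U\subset\mathbb{R}^m$, and let $u\mapsto H(u)$ be a smooth map from $U$ to the $n\times n$ Hermitian matrices (not necessarily affine in $u$). Let $\mathscr G=\mathrm{SU}(n)$ if $\operatorname{tr}H(u)=0$ for all $u\in U$, and $\mathscr G=\mathrm{U}(n)$ otherwise. Then the system $i\dot\psi(t)=H(u(t))\psi(t)$, $\psi(t)\in S^{2n-1}\subset\mathbb{C}^n$, $u(t)\in U$, is approximately controllable if and only if it is exactly controllable. Likewise, the system $i\dot g(t)=H(u(t))g(t)$, $g(t)\in\mathscr G$, $u(t)\in U$, is approximately controllable if and only if it is exactly controllable.
   Context: Controls are $L^\infty$ functions $u:[0,T]\to U$. For a control system on a connected manifold $M$, the reachable set from $q_0$ is the set of endpoints $q(T)$, $T\ge0$, of solutions starting at $q_0$ with admissible controls; the system is exactly controllable if the reachable set from every $q_0\in M$ is $M$, and approximately controllable if the reachable set from every $q_0\in M$ is dense in $M$. *)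

(* Defs.v *)
From HB Require Import structures.
From mathcomp Require Import all_boot all_order all_algebra.
From mathcomp Require Import all_classical all_reals all_analysis.
From mathcomp Require Import complex.
Set Implicit Arguments. Unset Strict Implicit. Unset Printing Implicit Defensive.
Import Order.TTheory GRing.Theory Num.Theory.
Import numFieldNormedType.Exports.
Local Open Scope ring_scope.
Local Open Scope classical_set_scope.

Section Defs.
Variable R : realType.
Local Notation C := R[i].

Definition adjmx (p q : nat) (A : 'M[C]_(p, q)) : 'M[C]_(q, p) :=
  (map_mx Num.conj A)^T.

Definition is_hermitian (n : nat) (A : 'M[C]_n) : Prop := adjmx A = A.

Definition sphere (n : nat) : set 'M[C]_(n, 1) :=
  [set psi | \sum_(i < n) `|psi i ord0| ^+ 2 = 1].

Definition unitary_grp (n : nat) : set 'M[C]_n :=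
  [set g | adjmx g *m g = 1%:M].
Definition sunitary_grp (n : nat) : set 'M[C]_n :=
  [set g | adjmx g *m g = 1%:M /\ \det g = 1].

Fixpoint Ck (m : nat) (k : nat) (V : set 'rV[R]_m) (f : 'rV[R]_m -> R) : Prop :=
  match k with
  | 0 => forall x, V x -> {for x, continuous f}
  | k.+1 => (forall x, V x -> forall v, derivable f x v) /\
            (forall v, Ck k V (fun x => 'D_v f x))
  end.

Definition smooth_real (m : nat) (V : set 'rV[R]_m) (f : 'rV[R]_m -> R) :=
  forall k, Ck k V f.

Definition smooth_on (m p q : nat) (U : set 'rV[R]_m)
  (H : 'rV[R]_m -> 'M[C]_(p, q)) : Prop :=
  exists V : set 'rV[R]_m, exists G : 'rV[R]_m -> 'M[C]_(p, q),
    open V /\ U `<=` V /\ {in U, H =1 G} /\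
    forall i j, smooth_real V (fun x => complex.Re (G x i j)) /\
                smooth_real V (fun x => complex.Im (G x i j)).

Definition admissible (m : nat) (U : set 'rV[R]_m) (T : R) (u : R -> 'rV[R]_m) : Prop :=
  (forall t, `[0, T] t -> U (u t)) /\
  (forall j, measurable_fun `[0, T] (fun t => u t ord0 j)) /\
  (exists M : R, forall j,
      {ae lebesgue_measure, forall t, `[0, T] t -> `|u t ord0 j| <= M}).

(* Caratheodory solution on [0,T] of  i X'(t) = H(u(t)) X(t),  X(0) = X0,
   i.e. X(t) = X0 + \int_0^t (-i) H(u(s)) X(s) ds  (componentwise, real and
   imaginary parts, with integrable integrands) for all t in [0,T]. *)
Definition is_solution (n p m : nat) (H : 'rV[R]_m -> 'M[C]_n)
  (u : R -> 'rV[R]_m) (T : R) (X0 : 'M[C]_(n, p)) (X : R -> 'M[C]_(n, p)) : Prop :=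
  X 0 = X0 /\
  forall t, `[0, T] t -> forall i j,
    let f := fun s => (- 'i) * (H (u s) *m X s) i j in
    lebesgue_measure.-integrable `[0, t] (fun s => (complex.Re (f s))%:E) /\
    lebesgue_measure.-integrable `[0, t] (fun s => (complex.Im (f s))%:E) /\
    complex.Re (X t i j) =
      complex.Re (X0 i j) + Rintegral lebesgue_measure `[0, t] (fun s => complex.Re (f s)) /\
    complex.Im (X t i j) =
      complex.Im (X0 i j) + Rintegral lebesgue_measure `[0, t] (fun s => complex.Im (f s)).

Definition reachable (n p m : nat) (M : set 'M[C]_(n, p)) (U : set 'rV[R]_m)
  (H : 'rV[R]_m -> 'M[C]_n) (q0 : 'M[C]_(n, p)) : set 'M[C]_(n, p) :=
  [set q | exists T : R, exists u : R -> 'rV[R]_m, exists X : R -> 'M[C]_(n, p),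
     0 <= T /\ admissible U T u /\ is_solution H u T q0 X /\
     (forall t, `[0, T] t -> M (X t)) /\ X T = q].

Definition dist2 (n p : nat) (A B : 'M[C]_(n, p)) : R :=
  \sum_(i < n) \sum_(j < p)
    (complex.Re (A i j - B i j) ^+ 2 + complex.Im (A i j - B i j) ^+ 2).

Definition exactly_controllable (n p m : nat) (M : set 'M[C]_(n, p))
  (U : set 'rV[R]_m) (H : 'rV[R]_m -> 'M[C]_n) : Prop :=
  forall q0, M q0 -> reachable M U H q0 = M.

Definition approximately_controllable (n p m : nat) (M : set 'M[C]_(n, p))
  (U : set 'rV[R]_m) (H : 'rV[R]_m -> 'M[C]_n) : Prop :=
  forall q0, M q0 -> forall q, M q -> forall eps : R, 0 < eps ->
    exists2 q', reachable M U H q0 q' & dist2 q q' < eps.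

Definition grp_of (n m : nat) (U : set 'rV[R]_m) (H : 'rV[R]_m -> 'M[C]_n)
  : set 'M[C]_n :=
  if `[< forall u, U u -> \tr (H u) = 0 >] then @sunitary_grp n else @unitary_grp n.

End Defs.

(* Main.v *)
Require Import Defs.
From HB Require Import structures.
From mathcomp Require Import all_boot all_order all_algebra.
From mathcomp Require Import fingroup perm spectral sesquilinear.
From mathcomp Require Import all_classical all_reals all_analysis.
From mathcomp Require Import complex.
From mathcomp Require Import measurable_realfun ring lra.
Set Implicit Arguments. Unset Strict Implicit. Unset Printing Implicit Defensive.
Import Order.TTheory GRing.Theory Num.Theory.
Import numFieldNormedType.Exports.
Local Open Scope ring_scope.
Local Open Scope classical_set_scope.

(** Only the implication from approximate to exact controllability needs an
    argument. Let [S] be the semigroup generated by the flows [exp (- i t H u)],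
    [t >= 0], and [K] its closure, a compact group. Piecewise constant controls
    show that [S q] is reachable from [q]; conversely every Caratheodory
    trajectory stays in [K q], because its distance to [K q] has zero derivative
    almost everywhere. So approximate controllability says that [K] is transitive
    on the sphere, or that [K] is the whole group, and it remains to show that
    [S = K].

    Let [V] be the real span of the [k A k^*] with [k] in [K] and [A] a generator
    [- i H u]. It is an ideal for every direction [X] tangent to [K] at [1]. If
    [X] is moreover orthogonal to [V], invariance of the trace form gives
    [[X, V] = 0], so that [X] commutes with [K] and is a scalar [i c] by Schur's
    lemma. If [c <> 0], orthogonality to [V] makes all [H u] traceless, so
    [\det = 1] on [K], which excludes the tangent direction [i c]. Hence [K] has no
    tangent direction orthogonal to [V], and the inverse function theorem applied
    to products of flows shows that [S] has nonempty interior in [K]. Since [S]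
    is dense in [K], this gives [S = K]. *)

(** * Norms and the trace form *)

Section MatrixNorm.
Variable R : realType.

(** The obstacle is that a dense semigroup need not be everything: an irrational flow on a torus is
    dense in its closure without being closed. There the closure has a tangent direction that no
    flow produces; the whole proof aims at excluding such directions. No Lie group structure on [K]
    is invoked. Tangent vectors are limits of difference quotients at the identity, and the
    dichotomy is elementary: either the only small [W] normal to [V] with [1 + W] in [K] is [0], or
    rescaling such [W] to norm 1 produces a tangent vector normal to [V]. Flows run for nonnegative
    times only, so inverses are absent from [S] and exist in [K] by recurrence. Hence a conjugate
    [k A k^*] is realized by [S] only approximately, with flow times centred at a positive value,
    and the open set found in [S] surrounds a point near the identity instead of the identity
    itself. The semigroup argument is carried out for real orthogonal matrices, because spans,
    orthogonality and dimension counts are over the reals; the complex structure returns at the end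
    as commutation with multiplication by [i]. *)

Lemma mx_norm_le (p q : nat) (A : 'M[R]_(p, q)) (c : R) :
  0 <= c -> (forall i j, `|A i j| <= c) -> `|A| <= c.
Proof.
move=> c0 h; rewrite [leLHS]mx_normrE.
by apply: bigmax_le => // -[i j] _; exact: h.
Qed.

Lemma le_mx_norm (p q : nat) (A : 'M[R]_(p, q)) i j : `|A i j| <= `|A|.
Proof.
rewrite [leRHS]mx_normrE.
exact: (@le_bigmax _ _ _ _ (fun ij : 'I_p * 'I_q => `|A ij.1 ij.2|) (i, j)).
Qed.

Lemma mx_norm_tr (p q : nat) (A : 'M[R]_(p, q)) : `|A^T| = `|A|.
Proof.
apply/le_anti/andP; split; apply: mx_norm_le => // i j; rewrite ?mxE.
  exact: le_mx_norm.
by have := le_mx_norm A^T j i; rewrite mxE.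
Qed.

Lemma mx_normM (p q r : nat) (A : 'M[R]_(p, q)) (B : 'M[R]_(q, r)) :
  `|A *m B| <= q%:R * `|A| * `|B|.
Proof.
apply: mx_norm_le => [|i j]; first by rewrite !mulr_ge0.
rewrite mxE (le_trans (ler_norm_sum _ _ _)) //.
rewrite (le_trans (y := \sum_(k < q) `|A| * `|B|)) //.
  apply: ler_sum => k _; rewrite normrM.
  by apply: ler_pM => //; exact: le_mx_norm.
by rewrite sumr_const card_ord -[leLHS]mulr_natl mulrA.
Qed.

Lemma mx_normMle (p q r : nat) (A : 'M[R]_(p, q)) (B : 'M[R]_(q, r)) (a b : R) :
  `|A| <= a -> `|B| <= b -> `|A *m B| <= q%:R * a * b.
Proof.
move=> ha hb; rewrite (le_trans (mx_normM A B)) //.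
by apply: ler_pM; rewrite ?mulr_ge0 // ler_wpM2l.
Qed.

Lemma mx_norm_row (p : nat) (A : 'M[R]_p) : A^T *m A = 1%:M -> `|A| <= 1.
Proof.
move=> hA; apply: mx_norm_le => // i j.
have /matrixP/(_ j j) := hA; rewrite !mxE eqxx => hs.
have : (A i j) ^+ 2 <= 1.
  rewrite -[leRHS]hs (bigD1 i) //= mxE -expr2 lerDl sumr_ge0 // => k _.
  by rewrite mxE -expr2 sqr_ge0.
by rewrite -ler_sqrt // sqrtr1 sqrtr_sqr.
Qed.

Lemma mx_norm1 (p : nat) : `|1%:M : 'M[R]_p| <= 1.
Proof. by apply: mx_norm_row; rewrite trmx1 mul1mx. Qed.

Lemma orthomxC (p : nat) (A : 'M[R]_p) : A^T *m A = 1%:M -> A *m A^T = 1%:M.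
Proof. by move/mulmx1C. Qed.

(** Replaces passages to the limit: an identity holds as soon as its defect is linear in the
    approximation error. The restriction [e <= 1] lets terms of higher order in [e] be absorbed in
    the constant. *)
Lemma eq0_le_eps (V : normedZmodType R) (x : V) (C : R) :
  (forall e : R, 0 < e -> e <= 1 -> `|x| <= C * e) -> x = 0.
Proof.
move=> h; apply/eqP; rewrite -normr_le0; apply/ler_addgt0Pl => e e0; rewrite addr0.
have C0 : 0 <= C by rewrite -[C]mulr1 (le_trans _ (h 1 _ _)).
have C1 : 0 < C + 1 by rewrite ltr_wpDl.
pose t := Order.min 1 (e / (C + 1)).
have t0 : 0 < t by rewrite lt_min ltr01 divr_gt0.
rewrite (le_trans (h t _ _)) // ?ge_min ?lexx //.
rewrite (le_trans (y := (C + 1) * (e / (C + 1)))) //.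
  by apply: ler_pM => //; [exact: ltW|rewrite lerDl|rewrite ge_min lexx orbT].
by rewrite mulrC divfK // gt_eqF.
Qed.

(** Compactness of closed balls, transported from row vectors by [mxvec]. The index can be taken
    beyond any [N], as needed for recurrence and for sequences with errors tending to zero. *)
Lemma bounded_mx_cluster (p q : nat) (u : nat -> 'M[R]_(p, q)) (c : R) :
  (forall n, `|u n| <= c) ->
  exists X, forall (e : R) N, 0 < e -> exists2 n, (N <= n)%N & `|u n - X| <= e.
Proof.
move=> hu; pose v n := mxvec (u n).
have hc : compact [set x : 'rV[R]_(p * q) | `|x| <= c].
  apply: bounded_closed_compact.
    by exists c; split; [exact: num_real|move=> y cy x /= /le_trans; apply; exact: ltW].
  rewrite (_ : [set x | _] = (fun x => `|x|) @^-1` [set y : R | y <= c]) //.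
  by apply: closed_comp; [move=> x _; exact: norm_continuous|exact: closed_le].
have c0 : 0 <= c := le_trans (normr_ge0 _) (hu 0%N).
have [|x [_ hx]] := hc (v @ \oo) _.
  exists 0%N => // n _ /=; apply: mx_norm_le => // i j; rewrite ord1.
  case/mxvec_indexP: j => a b; rewrite mxvecE.
  by rewrite (le_trans (le_mx_norm _ _ _)).
exists (vec_mx x) => e N e0.
have [_ [[n Nn <-]]] : v @` [set n | (N <= n)%N] `&` ball x e !=set0.
  apply: hx; last exact: nbhsx_ballx.
  by exists N => // n Nn; exists n.
rewrite -ball_normE /ball_ /= => hb; exists n => //.
apply: mx_norm_le => [|i j]; first exact: ltW.
rewrite !mxE distrC; apply: le_trans (ltW hb).
by have := le_mx_norm (x - v n) ord0 (mxvec_index i j); rewrite !mxE mxvecE.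
Qed.

End MatrixNorm.

Section TraceForm.
Variables (R : realType) (p q : nat).
Implicit Types A B C : 'M[R]_(p, q).

(** The Frobenius inner product; on skew matrices it is minus the trace form, which is where its
    invariance under brackets comes from. *)
Definition tdot A B : R := \tr (A^T *m B).

Lemma tdotC A B : tdot A B = tdot B A.
Proof. by rewrite /tdot -mxtrace_tr trmx_mul trmxK. Qed.

Lemma tdotDr A B C : tdot A (B + C) = tdot A B + tdot A C.
Proof. by rewrite /tdot mulmxDr mxtraceD. Qed.

Lemma tdotZr A (a : R) B : tdot A (a *: B) = a * tdot A B.
Proof. by rewrite /tdot -scalemxAr mxtraceZ. Qed.

Lemma tdotBr A B C : tdot A (B - C) = tdot A B - tdot A C.
Proof. by rewrite tdotDr -scaleN1r tdotZr mulN1r. Qed.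

Lemma tdot0r A : tdot A 0 = 0.
Proof. by rewrite /tdot mulmx0 mxtrace0. Qed.

Lemma tdotBl A B C : tdot (A - B) C = tdot A C - tdot B C.
Proof. by rewrite tdotC tdotBr !(tdotC C). Qed.

Lemma tdotZl (a : R) A B : tdot (a *: A) B = a * tdot A B.
Proof. by rewrite tdotC tdotZr tdotC. Qed.

Lemma tdot_eq0 A : tdot A A = 0 -> A = 0.
Proof.
move=> /eqP; rewrite /tdot /mxtrace psumr_eq0 => [/allP h|j _]; last first.
  by rewrite mxE sumr_ge0 // => k _; rewrite mxE -expr2 sqr_ge0.
apply/matrixP => i j; rewrite mxE.
have := h j (mem_index_enum _); rewrite mxE psumr_eq0 => [/allP h'|k _].
  by have := h' i (mem_index_enum _); rewrite mxE -expr2 /= sqrf_eq0 => /eqP.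
by rewrite mxE -expr2 sqr_ge0.
Qed.

Lemma tdot_bound A B : `|tdot A B| <= q%:R * p%:R * `|A| * `|B|.
Proof.
rewrite /tdot /mxtrace (le_trans (ler_norm_sum _ _ _)) //.
rewrite (le_trans (y := \sum_(i < q) p%:R * `|A| * `|B|)) //.
  apply: ler_sum => i _; rewrite -(mx_norm_tr A).
  exact: le_trans (le_mx_norm _ _ _) (mx_normM _ _).
by rewrite sumr_const card_ord -[leLHS]mulr_natl !mulrA.
Qed.

Lemma tdotDl A B C : tdot (A + B) C = tdot A C + tdot B C.
Proof. by rewrite tdotC tdotDr !(tdotC C). Qed.

Lemma tdot_ge0 A : 0 <= tdot A A.
Proof.
rewrite /tdot /mxtrace sumr_ge0 // => j _.
by rewrite mxE sumr_ge0 // => k _; rewrite mxE -expr2 sqr_ge0.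
Qed.

Lemma tdot_CauchySchwarz A B : tdot A B ^+ 2 <= tdot A A * tdot B B.
Proof.
have [B0|B0] := eqVneq (tdot B B) 0.
  by rewrite (tdot_eq0 B0) !tdot0r mulr0 expr0n.
have Bpos : 0 < tdot B B by rewrite lt_neqAle eq_sym B0 tdot_ge0.
have := tdot_ge0 (tdot B B *: A - tdot A B *: B).
rewrite !(tdotBl, tdotBr, tdotZl, tdotZr) (tdotC B A).
rewrite (_ : _ - _ = tdot B B * (tdot A A * tdot B B - tdot A B ^+ 2)); last by ring.
by rewrite pmulr_rge0 // subr_ge0.
Qed.

(** The Euclidean norm is exactly preserved by orthogonal matrices. The entrywise norm [|A|] is
    preserved only up to a factor, which would accumulate along a curve. *)
Definition fnorm A : R := Num.sqrt (tdot A A).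

Lemma ler_fnormD A B : fnorm (A + B) <= fnorm A + fnorm B.
Proof.
have nA : 0 <= fnorm A + fnorm B by rewrite addr_ge0 ?sqrtr_ge0.
rewrite -(@ler_pXn2r _ 2) ?nnegrE ?sqrtr_ge0 //.
rewrite sqrrD !sqr_sqrtr ?tdot_ge0 // !(tdotDl, tdotDr) (tdotC B A).
have : tdot A B <= fnorm A * fnorm B.
  rewrite (le_trans (ler_norm _)) // -sqrtr_sqr -sqrtrM ?tdot_ge0 //.
  by rewrite ler_wsqrtr // tdot_CauchySchwarz.
by rewrite mulr2n; lra.
Qed.

Lemma fnorm_le_sum A : fnorm A <= \sum_ij `|A ij.1 ij.2|.
Proof.
have n0 : 0 <= \sum_ij `|A ij.1 ij.2| by apply: sumr_ge0.
rewrite -(@ler_pXn2r _ 2) ?nnegrE ?sqrtr_ge0 // sqr_sqrtr ?tdot_ge0 //.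
rewrite /tdot /mxtrace; under eq_bigr do rewrite mxE.
rewrite exchange_big pair_big /= expr2 mulr_suml; apply: ler_sum => ij _.
rewrite mxE -[leLHS]ger0_norm ?normrM; last by rewrite -expr2 sqr_ge0.
rewrite ler_wpM2l // (bigD1 ij) //= lerDl; exact: sumr_ge0.
Qed.

Lemma fnorm_le A : fnorm A <= p%:R * q%:R * `|A|.
Proof.
rewrite (le_trans (fnorm_le_sum A)) //.
rewrite (le_trans (y := \sum_(ij : 'I_p * 'I_q) `|A|)) //.
  by apply: ler_sum => ij _; exact: le_mx_norm.
by rewrite sumr_const card_prod !card_ord -natrM mulr_natl.
Qed.

Lemma le_fnorm A : `|A| <= fnorm A.
Proof.
apply: mx_norm_le => [|i j]; first exact: sqrtr_ge0.
rewrite -sqrtr_sqr ler_wsqrtr // /tdot /mxtrace (bigD1 j) //= mxE (bigD1 i) //=.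
rewrite mxE -expr2 -addrA lerDl addr_ge0 // sumr_ge0 // => k _.
  by rewrite mxE -expr2 sqr_ge0.
by rewrite mxE sumr_ge0 // => l _; rewrite mxE -expr2 sqr_ge0.
Qed.

Lemma fnorm_orth (O : 'M[R]_p) A : O^T *m O = 1%:M -> fnorm (O *m A) = fnorm A.
Proof.
move=> oO; rewrite /fnorm /tdot trmx_mul.
by rewrite -mulmxA (mulmxA O^T) oO mul1mx.
Qed.

End TraceForm.

(** * Semigroups generated by orthogonal flows *)

Inductive semigrp (R : realType) (p : nat) (I : Type)
  (E : I -> R -> 'M[R]_p) : 'M[R]_p -> Prop :=
| semigrp1 : semigrp E 1%:M
| semigrpE i t g : 0 <= t -> semigrp E g -> semigrp E (E i t *m g).

Section Semigroup.
Variables (R : realType) (p : nat) (I : Type).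
Variables (E : I -> R -> 'M[R]_p) (A : I -> 'M[R]_p).
Hypothesis Eorth : forall i t, (E i t)^T *m E i t = 1%:M.
Hypothesis Ediff : forall i (e : R), 0 < e -> exists2 dl : R, 0 < dl &
  forall t, `|t| <= dl -> `|E i t - 1%:M - t *: A i| <= e * `|t|.

Local Notation S := (semigrp E).
Let c : R := p%:R.
Let c0 : 0 <= c. Proof. by rewrite /c. Qed.

Lemma semigrp_mul g h : S g -> S h -> S (g *m h).
Proof.
elim=> [|i t g' t0 _ IH] Sh; first by rewrite mul1mx.
by rewrite -mulmxA; apply: semigrpE => //; exact: IH.
Qed.

Lemma semigrp_flow i t : 0 <= t -> S (E i t).
Proof. by move=> t0; rewrite -[E i t]mulmx1; apply: semigrpE => //; exact: semigrp1. Qed.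

Lemma semigrp_orth g : S g -> g^T *m g = 1%:M.
Proof.
elim=> [|i t h _ _ IH]; first by rewrite trmx1 mul1mx.
by rewrite trmx_mul -mulmxA (mulmxA (E i t)^T) Eorth mul1mx.
Qed.

Definition semigrp_cl (g : 'M[R]_p) : Prop :=
  forall e : R, 0 < e -> exists2 s, S s & `|g - s| <= e.

Local Notation K := semigrp_cl.

Lemma semigrp_clW g : S g -> K g.
Proof. by move=> Sg e e0; exists g => //; rewrite subrr normr0 ltW. Qed.

Lemma semigrp_cl1 : K 1%:M.
Proof. exact: semigrp_clW (semigrp1 _). Qed.

Lemma semigrp_cl_closed g :
  (forall e : R, 0 < e -> exists2 k, K k & `|g - k| <= e) -> K g.
Proof.
move=> h e e0; have [k Kk gk] := h (e / 2) (divr_gt0 e0 (ltr0n _ 2)).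
have [s Ss ks] := Kk (e / 2) (divr_gt0 e0 (ltr0n _ 2)).
exists s => //; rewrite (le_trans (ler_distD k _ _)) // [leRHS](splitr e).
exact: lerD.
Qed.

Lemma semigrp_cl_orth g : K g -> g^T *m g = 1%:M.
Proof.
move=> Kg; apply/eqP; rewrite -subr_eq0; apply/eqP.
apply: (@eq0_le_eps _ _ _ (c * 2 + c)) => e e0 e1.
have [s Ss gs] := Kg e e0; have os := semigrp_orth Ss.
have s1 := mx_norm_row os.
have g2 : `|g^T| <= 2.
  rewrite mx_norm_tr -[g](subrK s) (le_trans (ler_normD _ _)) //.
  by rewrite -[2]/(1 + 1); apply: lerD => //; exact: le_trans e1.
have -> : g^T *m g - 1%:M = g^T *m (g - s) + (g - s)^T *m s.
  by rewrite -os [(g - s)^T]linearB /= mulmxBr mulmxBl addrA subrK.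
rewrite (le_trans (ler_normD _ _)) // mulrDl lerD //.
  exact: mx_normMle.
by rewrite -[c * e]mulr1; apply: mx_normMle => //; rewrite mx_norm_tr.
Qed.

Lemma semigrp_cl_norm g : K g -> `|g| <= 1.
Proof. by move/semigrp_cl_orth/mx_norm_row. Qed.

Lemma semigrp_cl_mul g h : K g -> K h -> K (g *m h).
Proof.
move=> Kg Kh; have g1 := semigrp_cl_norm Kg.
move=> e e0; pose e' := e / (c + c + 1).
have C0 : 0 < c + c + 1 by rewrite ltr_wpDl ?addr_ge0.
have e'0 : 0 < e' by rewrite divr_gt0.
have [s Ss gs] := Kg e' e'0; have [s' Ss' hs] := Kh e' e'0.
exists (s *m s'); first exact: semigrp_mul.
have -> : g *m h - s *m s' = g *m (h - s') + (g - s) *m s'.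
  by rewrite mulmxBr mulmxBl addrA subrK.
have h1 := mx_normMle g1 hs.
have h2 := mx_normMle gs (mx_norm_row (semigrp_orth Ss')).
rewrite (le_trans (ler_normD _ _)) // (le_trans (lerD h1 h2)) //.
rewrite -/c mulr1 mulr1 -mulrDl /e' mulrA ler_pdivrMr // mulrC.
by rewrite ler_pM2l // lerDl.
Qed.

(** Poincare recurrence: the powers of [s] cluster, so [s^m] is close to [s^k] for some [k > m], and
    multiplying by the isometry [s^-(m+1)] shows that [s^(k-m-1)] is close to the inverse of [s]. *)
Lemma semigrp_cl_tr g : K g -> K g^T.
Proof.
have KS s : S s -> K s^T.
  move=> Ss; have os := semigrp_orth Ss.
  pose u n := iter n (mulmx s) 1%:M.
  have uS n : S (u n) by elim: n => [|n IH]; [exact: semigrp1|exact: semigrp_mul].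
  have uD m n : u (m + n)%N = u m *m u n.
    by elim: m => [|m IH]; rewrite ?mul1mx //= IH mulmxA.
  have [X hX] := bounded_mx_cluster (fun n => mx_norm_row (semigrp_orth (uS n))).
  apply: semigrp_cl_closed => e e0; pose e' := e / (c * 2 + 1).
  have C0 : 0 < c * 2 + 1 by rewrite ltr_wpDl ?mulr_ge0.
  have e'0 : 0 < e' by rewrite divr_gt0.
  have [m _ um] := hX e' 0%N e'0; have [k mk uk] := hX e' m.+1 e'0.
  exists (u (k - m.+1)%N); first exact: semigrp_clW.
  have -> : s^T - u (k - m.+1)%N = (u m.+1)^T *m (u m - u k).
    rewrite -{2}(subnKC mk) mulmxBr uD (mulmxA (u m.+1)^T).
    rewrite (semigrp_orth (uS _)) mul1mx -addn1 uD /= mulmx1 trmx_mul -mulmxA.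
    by rewrite (semigrp_orth (uS _)) mulmx1.
  have h : `|u m - u k| <= e' + e'.
    by rewrite (le_trans (ler_distD X _ _)) // lerD // distrC.
  have h2 := mx_norm_row (semigrp_orth (uS m.+1)); rewrite -mx_norm_tr in h2.
  rewrite (le_trans (mx_normMle h2 h)) // -/c mulr1 -mulr2n -[e' *+ 2]mulr_natl.
  rewrite mulrA /e' mulrA ler_pdivrMr // mulrC ler_pM2l // lerDl //.
move=> Kg; apply: semigrp_cl_closed => e e0; have [s Ss gs] := Kg e e0.
by exists s^T; [exact: KS|rewrite -linearB mx_norm_tr].
Qed.

(** The contingent cone of [K] at the identity. Difference quotients along one sequence of times are
    enough, so no smoothness of [K] is presupposed. *)
Definition tangent (X : 'M[R]_p) : Prop :=
  forall e : R, 0 < e -> exists t, exists Y,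
    [/\ 0 < t, t <= e, `|Y - X| <= e & K (1%:M + t *: Y)].

(** Conjugating by all of [K] makes the set stable under conjugation, hence its span stable under
    brackets with tangent directions. *)
Definition generator (B : 'M[R]_p) : Prop :=
  exists k, exists2 i, K k & B = k *m A i *m k^T.

Definition normal_vector (W : 'M[R]_p) : Prop :=
  forall B, generator B -> tdot W B = 0.

(** The curve [k (E i t) k^T] stays in [K] for [t >= 0] and leaves the identity with velocity
    [B]. *)
Lemma tangent_generator B : generator B -> tangent B.
Proof.
move=> [k [i Kk ->]] e e0; pose e' := e / (c * c + 1).
have C0 : 0 < c * c + 1 by rewrite ltr_wpDl ?mulr_ge0.
have e'0 : 0 < e' by rewrite divr_gt0.
have [dl dl0 hdl] := Ediff i e'0.
pose t := Order.min e dl; have t0 : 0 < t by rewrite lt_min e0.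
exists t, (k *m (t^-1 *: (E i t - 1%:M)) *m k^T).
have tn : `|t| = t by rewrite gtr0_norm.
split=> //; first by rewrite ge_min lexx.
  rewrite -mulmxBl -mulmxBr; set D := _ - A i.
  have hD : `|D| <= e'.
    have -> : D = t^-1 *: (E i t - 1%:M - t *: A i).
      by rewrite scalerBr scalerA mulVf ?scale1r // gt_eqF.
    rewrite normrZ normfV tn ler_pdivrMl // [leRHS]mulrC.
    by have := hdl t; rewrite tn ge_min lexx orbT; exact.
  have k1 := semigrp_cl_norm Kk; have k2 := k1; rewrite -mx_norm_tr in k2.
  rewrite (le_trans (mx_normMle (mx_normMle k1 hD) k2)) // -/c !mulr1.
  by rewrite mulrA /e' mulrA ler_pdivrMr // mulrC ler_pM2l // lerDl.
have -> : 1%:M + t *: (k *m (t^-1 *: (E i t - 1%:M)) *m k^T) = k *m E i t *m k^T.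
  rewrite -scalemxAr -scalemxAl scalerA divff ?gt_eqF // scale1r.
  by rewrite mulmxBr mulmxBl mulmx1 (orthomxC (semigrp_cl_orth Kk)) addrC subrK.
apply: semigrp_cl_mul; last exact: semigrp_cl_tr.
apply: semigrp_cl_mul => //; apply: semigrp_clW; apply: semigrp_flow; exact: ltW.
Qed.

(** Orthogonality of [1 + t Y], divided by [t], reads [Y + Y^T + t Y^T Y = 0]; let [t] tend to
    zero. *)
Lemma tangent_skew X : tangent X -> X^T = - X.
Proof.
move=> tX; apply/eqP; rewrite -addr_eq0; apply/eqP.
apply: (@eq0_le_eps _ _ _ (1 + 1 + c * (`|X| + 1) * (`|X| + 1))) => e e0 e1.
have [t [Y [t0 te YX KY]]] := tX e e0.
have hY : Y + Y^T + t *: (Y^T *m Y) = 0.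
  apply: (scalerI (lt0r_neq0 t0)); rewrite scaler0.
  rewrite -[RHS](subrr (1%:M : 'M[R]_p)) -[X in _ = X + _](semigrp_cl_orth KY).
  rewrite [(_ + _)^T]linearD /= [(_ *: _)^T]linearZ /= trmx1.
  rewrite mulmxDl mul1mx mulmxDr mulmx1 -!scalemxAl -!scalemxAr !scalerDr.
  by apply/matrixP => i j; rewrite !mxE; ring.
have -> : X^T + X = (X - Y)^T + (X - Y) - t *: (Y^T *m Y).
  apply/eqP; rewrite -subr_eq0 -hY linearB /=; apply/eqP.
  by rewrite !opprD !opprK !addrA; apply/matrixP => i j; rewrite !mxE; ring.
have Yn : `|Y| <= `|X| + 1.
  by rewrite -[Y](subrK X) addrC (le_trans (ler_normD _ _)) // lerD2l (le_trans YX).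
rewrite (le_trans (ler_normB _ _)) // [leRHS]mulrDl; apply: lerD.
  rewrite (le_trans (ler_normD _ _)) // mulrDl mul1r mx_norm_tr (distrC X).
  exact: lerD.
rewrite normrZ gtr0_norm // mulrC; apply: ler_pM => //; first exact: ltW.
by apply: mx_normMle => //; rewrite mx_norm_tr.
Qed.

Lemma generator_conj g B : K g -> generator B -> generator (g *m B *m g^T).
Proof.
move=> Kg [k [i Kk ->]]; exists (g *m k), i; first exact: semigrp_cl_mul.
by rewrite trmx_mul !mulmxA.
Qed.

(* Differentiate [<W, g B g^T> = 0] along [g] tending to the identity in the
   direction [X]. *)
Lemma normal_tangent X W B : tangent X -> normal_vector W -> generator B ->
  tdot W (X *m B - B *m X) = 0.
Proof.
move=> tX nW gB; have sX := tangent_skew tX.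
have -> : X *m B - B *m X = X *m B + B *m X^T by rewrite sX mulmxN.
pose n := `|X| + 1.
apply: (@eq0_le_eps _ _ _
  (c * c * `|W| * (c * `|B| + c * `|B| + c * (c * n * `|B|) * n))) => e e0 e1.
have [t [Y [t0 te YX KY]]] := tX e e0.
have Yn : `|Y| <= n.
  by rewrite -[Y](subrK X) addrC (le_trans (ler_normD _ _)) // lerD2l (le_trans YX).
have h0 := nW _ (generator_conj KY gB).
have h1 : tdot W (Y *m B + B *m Y^T + t *: (Y *m B *m Y^T)) = 0.
  apply: (mulfI (lt0r_neq0 t0)); rewrite mulr0 -tdotZr -[RHS]h0.
  rewrite -[RHS]subr0 -[Z in _ = _ - Z](nW _ gB) -tdotBr; congr (tdot W _).
  rewrite [(_ + _)^T]linearD /= trmx1 [(_ *: _)^T]linearZ /=.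
  rewrite !(mulmxDl, mulmxDr, mulmx1, mul1mx).
  rewrite -?(scalemxAl, scalemxAr) -?(scalemxAl, scalemxAr) -?scalemxAl.
  by apply/matrixP => i j; rewrite !mxE; ring.
have -> : tdot W (X *m B + B *m X^T) =
    tdot W ((X - Y) *m B + B *m (X - Y)^T - t *: (Y *m B *m Y^T)).
  rewrite -[RHS]addr0 -[Z in _ = _ + Z]h1 -tdotDr; congr (tdot W _).
  rewrite [(_ - _)^T]linearB /= mulmxBl mulmxBr.
  by apply/matrixP => i j; rewrite !mxE; ring.
rewrite (le_trans (tdot_bound _ _)) // -/c -[leRHS]mulrA ler_wpM2l ?mulr_ge0 //.
rewrite (le_trans (ler_normB _ _)) // [leRHS]mulrDl; apply: lerD.
  rewrite (le_trans (ler_normD _ _)) // mulrDl; apply: lerD.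
    by rewrite (le_trans (mx_normMle (_ : _ <= e) (lexx _))) // 1?distrC // -/c mulrAC.
  by rewrite (le_trans (mx_normMle (lexx _) (_ : _ <= e))) // mx_norm_tr distrC.
rewrite normrZ gtr0_norm // [leRHS]mulrC; apply: ler_pM => //; first exact: ltW.
by rewrite -/c; apply: mx_normMle; [exact: mx_normMle|rewrite mx_norm_tr].
Qed.

(** [normal_tangent] is used twice. With the tangent direction [B'], it gives [<[X, B], B'> = <X,
    [B, B']> = 0], so [[X, B]] is again normal. With the tangent direction [X] and [W = [X, B]], it
    then gives [<[X, B], [X, B]> = 0]. *)
Lemma normal_tangent_comm X B : tangent X -> normal_vector X -> generator B ->
  X *m B = B *m X.
Proof.
move=> tX nX gB; apply/eqP; rewrite -subr_eq0; apply/eqP/tdot_eq0.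
apply: normal_tangent => // B' gB'.
have sX := tangent_skew tX.
have sB := tangent_skew (tangent_generator gB).
have := normal_tangent (tangent_generator gB') nX gB.
rewrite /tdot sX [(_ - _)^T]linearB /= !trmx_mul sX sB.
rewrite !(mulmxN, mulNmx, opprK) !(mulmxBr, mulmxBl) !linearN /= !linearB /=.
rewrite -(mulmxA B) (mxtrace_mulC B) !(mulmxA, mulNmx, opprK) => h; lra.
Qed.

(* [L] can be matched to first order at [0], with arbitrarily small Lipschitz
   error, by a map with values in the semigroup. *)
Definition near_affine (e r : R) (L f : 'M[R]_p -> 'M[R]_p) : Prop :=
  forall Z Z' : 'M[R]_p, `|Z| <= r -> `|Z'| <= r ->
    `|f Z - 1%:M| <= e /\ `|f Z - f Z' - (L Z - L Z')| <= e * `|Z - Z'|.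

Definition lipschitz_mx (L : 'M[R]_p -> 'M[R]_p) : Prop :=
  exists2 C : R, 0 <= C & forall Z Z' : 'M[R]_p, `|L Z - L Z'| <= C * `|Z - Z'|.

(** The value [f 0] is only close to the identity: a parameter of either sign has to enter as a time
    [t >= 0], which requires a positive offset. *)
Definition realizable (L : 'M[R]_p -> 'M[R]_p) : Prop :=
  lipschitz_mx L /\
  forall e : R, 0 < e -> exists2 r : R, 0 < r &
    exists2 f, near_affine e r L f & forall Z : 'M[R]_p, `|Z| <= r -> S (f Z).

Lemma near_affineW e r r' L f : r' <= r -> near_affine e r L f -> near_affine e r' L f.
Proof. by move=> rr h Z Z' hZ hZ'; apply: h; exact: le_trans rr. Qed.

(** The product rule near the identity. It is stated for [near_affine] instead of [realizable]
    because [semigrp_closed] applies it to a second factor [1 + eta Z] outside the semigroup. *)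
Lemma near_affineM L1 L2 : lipschitz_mx L1 -> lipschitz_mx L2 ->
  forall e : R, 0 < e -> exists2 e' : R, 0 < e' & forall r f1 f2,
    near_affine e' r L1 f1 -> near_affine e' r L2 f2 ->
    near_affine e r (fun Z => L1 Z + L2 Z) (fun Z => f1 Z *m f2 Z).
Proof.
move=> [C1 C10 hL1] [C2 C20 hL2] e e0.
pose D := c * (2 + C1 + 2 + C2) + 1.
have D0 : 0 < D by rewrite ltr_wpDl // mulr_ge0 // !addr_ge0.
pose e' := Order.min 1 (e / D).
have e'0 : 0 < e' by rewrite lt_min ltr01 divr_gt0.
have e'1 : e' <= 1 by rewrite ge_min lexx.
have e'D : D * e' <= e by rewrite mulrC -ler_pdivlMr // ge_min lexx orbT.
exists e' => // r f1 f2 h1 h2 Z Z' hZ hZ'.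
have [f1Z d1] := h1 _ _ hZ hZ'; have [f2Z d2] := h2 _ _ hZ hZ'.
have [f1Z' _] := h1 _ _ hZ' hZ.
have two (M : 'M[R]_p) : `|M - 1%:M| <= e' -> `|M| <= 2.
  move=> hM; rewrite -[M](subrK 1%:M) (le_trans (ler_normD _ _)) //.
  by rewrite -[2]/(1 + 1) lerD ?mx_norm1 // (le_trans hM).
split=> /=.
  have -> : f1 Z *m f2 Z - 1%:M = (f1 Z - 1%:M) *m f2 Z + (f2 Z - 1%:M).
    by rewrite mulmxBl mul1mx addrA subrK.
  rewrite (le_trans (ler_normD _ _)) // (le_trans _ e'D) // mulrDl mul1r lerD //.
  rewrite (le_trans (mx_normMle f1Z (two _ f2Z))) // -/c mulrAC.
  by rewrite ler_wpM2r ?(ltW e'0) // ler_wpM2l //; lra.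
set N := `|Z - Z'|.
(* Each of the four terms has one factor small with [e']: either a Lipschitz error or the distance
   of [f1], [f2] to the identity. The other factors are bounded by 2 or by the Lipschitz constants
   of [L1], [L2]. *)
have -> : f1 Z *m f2 Z - f1 Z' *m f2 Z' - (L1 Z + L2 Z - (L1 Z' + L2 Z')) =
    (f1 Z - f1 Z' - (L1 Z - L1 Z')) *m f2 Z + (L1 Z - L1 Z') *m (f2 Z - 1%:M) +
    f1 Z' *m (f2 Z - f2 Z' - (L2 Z - L2 Z')) + (f1 Z' - 1%:M) *m (L2 Z - L2 Z').
  rewrite !(mulmxBr, mulmxBl, mul1mx, mulmx1).
  by apply/matrixP => i j; rewrite !mxE; ring.
have k1 := mx_normMle d1 (two _ f2Z); have k2 := mx_normMle (hL1 Z Z') f2Z.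
have k3 := mx_normMle (two _ f1Z') d2; have k4 := mx_normMle f1Z' (hL2 Z Z').
rewrite (le_trans (ler_normD _ _)) //.
rewrite (le_trans (lerD (ler_normD _ _) k4)) //.
rewrite (le_trans (lerD (lerD (ler_normD _ _) k3) (lexx _))) //.
rewrite (le_trans (lerD (lerD (lerD k1 k2) (lexx _)) (lexx _))) // -/N -/c.
apply: (@le_trans _ _ (D * e' * N)); last by apply: ler_wpM2r => //; exact: normr_ge0.
have -> : D * e' * N = c * (e' * N) * 2 + c * (C1 * N) * e' + c * 2 * (e' * N) +
  c * e' * (C2 * N) + e' * N by rewrite /D; ring.
by rewrite lerDl; apply: mulr_ge0; [exact: ltW|exact: normr_ge0].
Qed.

Lemma realizable0 : realizable (fun=> 0).
Proof.
split; first by exists 0 => // Z Z'; rewrite subrr normr0 mul0r.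
move=> e e0; exists 1 => //; exists (fun=> 1%:M); last by move=> *; exact: semigrp1.
by move=> Z Z' _ _; split; rewrite ?subrr ?subrr ?subr0 normr0 ?mulr_ge0 // ltW.
Qed.

Lemma realizableD L1 L2 : realizable L1 -> realizable L2 ->
  realizable (fun Z => L1 Z + L2 Z).
Proof.
move=> [l1 h1] [l2 h2]; split.
  have [C1 C10 hL1] := l1; have [C2 C20 hL2] := l2.
  exists (C1 + C2) => [|Z Z']; first exact: addr_ge0.
  rewrite opprD addrACA mulrDl (le_trans (ler_normD _ _)) //.
  exact: lerD (hL1 _ _) (hL2 _ _).
move=> e e0; have [e' e'0 hM] := near_affineM l1 l2 e0.
have [r1 r10 [f1 n1 S1]] := h1 e' e'0; have [r2 r20 [f2 n2 S2]] := h2 e' e'0.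
have m1 : Order.min r1 r2 <= r1 by rewrite ge_min lexx.
have m2 : Order.min r1 r2 <= r2 by rewrite ge_min lexx orbT.
exists (Order.min r1 r2); first by rewrite lt_min r10.
exists (fun Z => f1 Z *m f2 Z); first by apply: hM; [exact: near_affineW n1|exact: near_affineW n2].
by move=> Z hZ; apply: semigrp_mul; [apply: S1|apply: S2]; apply: le_trans hZ _.
Qed.

Lemma realizable_comp L T : lipschitz_mx T -> T 0 = 0 -> realizable L ->
  realizable (fun Z => L (T Z)).
Proof.
move=> [C C0 hT] T0 [[D D0 hL] h]; split.
  exists (D * C) => [|Z Z']; first exact: mulr_ge0.
  by rewrite -mulrA (le_trans (hL _ _)) // ler_wpM2l.
have C1 : 0 < C + 1 by rewrite ltr_wpDl.
move=> e e0; have [|r r0 [f n Sf]] := h (Order.min e (e / (C + 1))).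
  by rewrite lt_min e0 divr_gt0.
have hr Z : `|Z| <= r / (C + 1) -> `|T Z| <= r.
  rewrite ler_pdivlMr // => hZ; have := hT Z 0; rewrite T0 !subr0 => /le_trans.
  by apply; apply: le_trans hZ; rewrite mulrC ler_wpM2l // lerDl.
exists (r / (C + 1)); first exact: divr_gt0.
exists (fun Z => f (T Z)); last by move=> Z /hr; exact: Sf.
move=> Z Z' /hr hZ /hr hZ'; have [n1 n2] := n _ _ hZ hZ'; split.
  by rewrite (le_trans n1) // ge_min lexx.
rewrite (le_trans n2) // (le_trans (y := e / (C + 1) * (C * `|Z - Z'|))) //.
  by apply: ler_pM => //; rewrite ?ge_min ?lexx ?orbT // le_min !ltW // divr_gt0.
rewrite mulrA ler_wpM2r // mulrAC ler_pdivrMr // ler_pM2l //.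
by rewrite lerDl.
Qed.
End Semigroup.

(** * First-order realization of the orthogonal projection onto the generators *)

Section SemigroupReach.
Variables (R : realType) (p : nat) (I : Type).
Variables (E : I -> R -> 'M[R]_p) (A : I -> 'M[R]_p).
Hypothesis ED : forall i s t, E i (s + t) = E i s *m E i t.
Hypothesis Eorth : forall i t, (E i t)^T *m E i t = 1%:M.
Hypothesis Ediff : forall i (e : R), 0 < e -> exists2 dl : R, 0 < dl &
  forall t, `|t| <= dl -> `|E i t - 1%:M - t *: A i| <= e * `|t|.

Local Notation S := (semigrp E).
Local Notation K := (semigrp_cl E).
Let c : R := p%:R.
Let c0 : 0 <= c. Proof. by rewrite /c. Qed.

(** Differentiability at time [0] becomes strict differentiability near [0], since
    [E i t - E i s = E i s (E i (t - s) - 1)]. *)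
Lemma flow_near i (e : R) : 0 < e -> exists2 dl : R, 0 < dl &
  forall s t, `|s| <= dl -> `|t| <= dl -> `|E i t - 1%:M| <= e /\
    `|E i t - E i s - (t - s) *: A i| <= e * `|t - s|.
Proof.
move=> e0; set a := `|A i|; have a0 : 0 <= a by exact: normr_ge0.
pose M := c + c * a + 1; have M0 : 0 < M by rewrite ltr_wpDl // addr_ge0 // mulr_ge0.
have M1 : 1 <= M by rewrite lerDr addr_ge0 // mulr_ge0.
pose e2 := Order.min 1 (e / M).
have e20 : 0 < e2 by rewrite lt_min ltr01 divr_gt0.
have e21 : e2 <= 1 by rewrite ge_min lexx.
have e2M : M * e2 <= e by rewrite mulrC -ler_pdivlMr // ge_min lexx orbT.
have e2e : e2 <= e by apply: le_trans e2M; rewrite ler_peMl // ltW.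
have [d1 d10 hd] := Ediff i e20.
have a1 : 0 < a + 1 by rewrite ltr_wpDl.
pose dl := Order.min (d1 / 2) (e2 / (a + 1)).
have dl1 : dl <= d1 / 2 by rewrite ge_min lexx.
have dl2 : dl <= e2 / (a + 1) by rewrite ge_min lexx orbT.
have dd : d1 / 2 <= d1 by lra.
exists dl; first by rewrite lt_min !divr_gt0.
have hE s : `|s| <= dl -> `|E i s - 1%:M| <= e2.
  move=> hs; rewrite -(subrK (s *: A i) (_ - _)) (le_trans (ler_normD _ _)) //.
  rewrite (le_trans (lerD (hd _ _) (lexx _))) ?(le_trans hs) ?(le_trans dl1) //.
  rewrite normrZ -/a mulrC -mulrDr (le_trans (ler_wpM2l _ (_ : _ <= 1 + a))) ?lerD2r //.
  by rewrite addrC -ler_pdivlMr // (le_trans hs).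
move=> s t hs ht; split; first exact: le_trans (hE t ht) e2e.
have -> : E i t - E i s - (t - s) *: A i =
    E i s *m (E i (t - s) - 1%:M - (t - s) *: A i) +
    (t - s) *: ((E i s - 1%:M) *m A i).
  rewrite !(mulmxBr, mulmxBl, mul1mx, mulmx1) -ED addrCA subrr addr0 scalerBr.
  rewrite -scalemxAr addrA; congr (_ - _); by rewrite subrK.
have ts : `|t - s| <= d1.
  by rewrite (le_trans (ler_normB _ _)) // (splitr d1) lerD // (le_trans _ dl1).
have k1 := mx_normMle (mx_norm_row (Eorth i s)) (hd _ ts).
have k2 := mx_normMle (hE s hs) (lexx a).
rewrite (le_trans (ler_normD _ _)) // normrZ.
rewrite (le_trans (lerD k1 (ler_wpM2l (normr_ge0 _) k2))) // -/c.
apply: (@le_trans _ _ (M * e2 * `|t - s|)); last exact: ler_wpM2r.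
have -> : M * e2 * `|t - s| = c * 1 * (e2 * `|t - s|) + `|t - s| * (c * e2 * a) +
   e2 * `|t - s| by rewrite /M; ring.
by rewrite lerDl mulr_ge0 // ltW.
Qed.

(** Neither [k] nor [k^T] need lie in [S], so they are replaced by nearby [s1], [s2] in [S]. The
    derivative [s1 A s2] differs from [B] by a small multiple of the error, which the Lipschitz
    tolerance of [near_affine] absorbs. *)
Lemma realizable_generator (x : 'M[R]_p -> R) C B : 0 <= C ->
  (forall Z Z', `|x Z - x Z'| <= C * `|Z - Z'|) -> x 0 = 0 ->
  generator E A B -> realizable E (fun Z => x Z *: B).
Proof.
move=> C0 hx x0 [k [i Kk ->]]; set B' := _ *m _; split.
  exists (C * `|B'|) => [|Z Z']; first exact: mulr_ge0.
  by rewrite -scalerBl normrZ mulrAC ler_wpM2r.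
move=> e e0; set a := `|A i|; have a0 : 0 <= a by exact: normr_ge0.
pose M := c * c + 2 * c + (c * c + 2 * (c * c) * a) * C + 1.
have M0 : 0 < M by rewrite ltr_wpDl // ?(addr_ge0, mulr_ge0).
pose e1 := e / M; have e10 : 0 < e1 by rewrite divr_gt0.
have e1M : M * e1 = e by rewrite mulrC divfK // gt_eqF.
have [dl dl0 hdl] := flow_near i e10.
have [s1 S1 ks1] := Kk e1 e10; have [s2 S2 ks2] := semigrp_cl_tr Eorth Kk e10.
rewrite distrC in ks1; rewrite distrC in ks2.
have C1 : 0 < C + 1 by rewrite ltr_wpDl.
have k1 := semigrp_cl_norm Eorth Kk; have k1' := k1; rewrite -mx_norm_tr in k1'.
have s11 := mx_norm_row (semigrp_orth Eorth S1).
have s21 := mx_norm_row (semigrp_orth Eorth S2).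
(* On this ball [|x Z| <= dl / 2], so the flow time [dl / 2 + x Z] lies between [0] and [dl]: it is
   admissible for [S] and within the range of [flow_near]. *)
pose r := dl / 2 / (C + 1).
have hr Z : `|Z| <= r -> `|x Z| <= dl / 2.
  rewrite /r ler_pdivlMr // => hZ; have := hx Z 0; rewrite x0 !subr0 => /le_trans.
  by apply; apply: le_trans hZ; rewrite mulrC ler_wpM2l // lerDl.
have hr' Z : `|Z| <= r -> `|dl / 2 + x Z| <= dl.
  move=> /hr hZ; rewrite (le_trans (ler_normD _ _)) // gtr0_norm ?divr_gt0 //.
  by rewrite [leRHS](splitr dl) lerD2l.
exists r; first by rewrite !divr_gt0.
exists (fun Z => s1 *m E i (dl / 2 + x Z) *m s2) => [Z Z' hZ hZ'|Z hZ]; last first.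
  apply: semigrp_mul => //; apply: semigrp_mul => //; apply: semigrp_flow.
  by have := hr _ hZ; rewrite ler_norml -subr_ge0 opprK addrC => /andP[].
have [n1 n2] := hdl _ _ (hr' _ hZ') (hr' _ hZ); split.
  have -> : s1 *m E i (dl / 2 + x Z) *m s2 - 1%:M =
      s1 *m (E i (dl / 2 + x Z) - 1%:M) *m s2 + (s1 - k) *m s2 + k *m (s2 - k^T).
    rewrite !(mulmxBr, mulmxBl, mul1mx, mulmx1) (orthomxC (semigrp_cl_orth Eorth Kk)).
    by rewrite !addrA !subrK.
  rewrite (le_trans (ler_normD _ _)) // (le_trans (lerD (ler_normD _ _) (lexx _))) //.
  rewrite (le_trans (lerD (lerD (mx_normMle (mx_normMle s11 n1) s21)
    (mx_normMle ks1 s21)) (mx_normMle k1 ks2))) // -/c -e1M.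
  rewrite -subr_ge0; have -> : M * e1 - (c * (c * 1 * e1) * 1 + c * e1 * 1 + c * 1 * e1) =
    ((c * c + 2 * (c * c) * a) * C + 1) * e1 by rewrite /M; ring.
  by apply: mulr_ge0; [rewrite !(addr_ge0, mulr_ge0)|exact: ltW].
rewrite [_ + x Z - _](_ : _ = x Z - x Z') in n2; last by ring.
set D := x Z - x Z'; set F := E i _; set F' := E i (_ + x Z').
have -> : s1 *m F *m s2 - s1 *m F' *m s2 - (x Z *: B' - x Z' *: B') =
    s1 *m (F - F' - D *: A i) *m s2 + D *: ((s1 - k) *m A i *m s2) +
    D *: (k *m A i *m (s2 - k^T)).
  rewrite -scalerBl -/D !(mulmxBr, mulmxBl) -?scalemxAr -?scalemxAl !scalerBr.
  by rewrite -/B' !addrA !subrK.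
rewrite (le_trans (ler_normD _ _)) // (le_trans (lerD (ler_normD _ _) (lexx _))) //.
rewrite !normrZ.
have hD : `|D| <= C * `|Z - Z'| by exact: hx.
rewrite (le_trans (lerD (lerD (mx_normMle (mx_normMle s11 n2) s21)
    (ler_wpM2l (normr_ge0 _) (mx_normMle (mx_normMle ks1 (lexx a)) s21)))
    (ler_wpM2l (normr_ge0 _) (mx_normMle (mx_normMle k1 (lexx a)) ks2)))) // -/c.
have -> : c * (c * 1 * (e1 * `|D|)) * 1 + `|D| * (c * (c * e1 * a) * 1) +
  `|D| * (c * (c * 1 * a) * e1) = (c * c + 2 * (c * c) * a) * e1 * `|D| by ring.
have P0 : 0 <= (c * c + 2 * (c * c) * a) * e1.
  by apply: mulr_ge0; [rewrite !(addr_ge0, mulr_ge0)|exact: ltW].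
rewrite (le_trans (ler_wpM2l P0 hD)) // -e1M [leLHS]mulrA.
apply: ler_wpM2r; first exact: normr_ge0.
rewrite -subr_ge0 (_ : _ - _ = (c * c + 2 * c + 1) * e1); last by rewrite /M; ring.
by apply: mulr_ge0; [rewrite !(addr_ge0, mulr_ge0)|exact: ltW].
Qed.

(** Gram-Schmidt. The new orthogonal direction [w = B - L B] need not be a generator, whereas [B] is
    one; so [L Z + x w] is written [L (Z - x B) + x B], which is realizable. The last clause says in
    dual form that [L Z] lies in the span of [bs]. *)
Lemma realizable_projection_seq (bs : seq 'M[R]_p) :
  {in bs, forall B, generator E A B} ->
  exists L, [/\ realizable E L, L 0 = 0,
    forall B, B \in bs -> forall Z, tdot B (Z - L Z) = 0 &
    forall W, {in bs, forall B, tdot B W = 0} -> forall Z, tdot (L Z) W = 0].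
Proof.
elim: bs => [_|B bs IH gbs].
  exists (fun=> 0); split=> //; first exact: realizable0.
  by move=> W _ Z; rewrite tdotC tdot0r.
have [L [rL L0 nL pL]] : exists L, [/\ realizable E L, L 0 = 0,
    forall B, B \in bs -> forall Z, tdot B (Z - L Z) = 0 &
    forall W, {in bs, forall B, tdot B W = 0} -> forall Z, tdot (L Z) W = 0].
  by apply: IH => B' B'b; apply: gbs; rewrite in_cons B'b orbT.
pose w := B - L B; have Bw : B = w + L B by rewrite subrK.
have [w0|w0] := eqVneq (tdot w w) 0.
  exists L; split=> // [B' + Z|W hW Z].
    rewrite in_cons => /predU1P[->|/nL //].
    rewrite Bw (tdot_eq0 w0) add0r; apply: pL => B'' B''b; exact: nL.
  by apply: pL => B' B'b; apply: hW; rewrite in_cons B'b orbT.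
pose x Z := tdot w Z / tdot w w.
have [C C0 hx] : exists2 C : R, 0 <= C & forall Z Z', `|x Z - x Z'| <= C * `|Z - Z'|.
  exists (c * c * `|w| / `|tdot w w|) => [|Z Z']; first by rewrite !mulr_ge0 ?invr_ge0.
  rewrite /x -mulrBl -tdotBr normrM normfV mulrAC ler_wpM2r ?invr_ge0 //.
  exact: tdot_bound.
have x0 : x 0 = 0 by rewrite /x tdot0r mul0r.
pose T Z := Z - x Z *: B.
have T0 : T 0 = 0 by rewrite /T x0 scale0r subr0.
have lT : lipschitz_mx T.
  exists (1 + C * `|B|) => [|Z Z']; first by rewrite addr_ge0 ?mulr_ge0.
  rewrite /T opprD addrACA -opprD -scalerBl (le_trans (ler_normB _ _)) //.
  by rewrite mulrDl mul1r lerD2l normrZ mulrAC ler_wpM2r.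
have wB : tdot w B = tdot w w.
  by rewrite Bw tdotDr (tdotC _ (L B)) pL ?addr0 // => B' B'b; apply: nL.
have hZ Z : Z - (L (T Z) + x Z *: B) = T Z - L (T Z).
  by rewrite /T opprD addrA addrAC.
exists (fun Z => L (T Z) + x Z *: B); split.
- apply: realizableD => //; first exact: realizable_comp.
  apply: (realizable_generator C0 hx x0); apply: gbs.
  by rewrite in_cons eqxx.
- by rewrite T0 L0 x0 scale0r addr0.
- move=> B' + Z; rewrite hZ in_cons => /predU1P[->|/nL //].
  rewrite Bw tdotC tdotDr !(tdotC _ (w)) !(tdotC _ (L B)).
  rewrite [X in _ + X]pL ?addr0; last by move=> B'' B''b; exact: nL.
  rewrite tdotBr (tdotC _ (L _)) [X in _ - X]pL ?subr0; last by move=> B'' B''b; exact: nL.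
  by rewrite /T tdotBr tdotZr wB /x divfK // subrr.
- move=> W hW Z; rewrite tdotC tdotDr tdotZr !(tdotC W) (hW B) ?in_cons ?eqxx // mulr0 addr0.
  by apply: pL => B' B'b; apply: hW; rewrite in_cons B'b orbT.
Qed.

(** Take finitely many generators whose span has maximal dimension: adjoining another one cannot
    enlarge it. *)
Lemma generator_finite_span : exists2 bs : seq 'M[R]_p,
  {in bs, forall B, generator E A B} &
  forall W, {in bs, forall B, tdot B W = 0} ->
    forall B, generator E A B -> tdot B W = 0.
Proof.
pose P k := `[< exists2 bs : seq 'M[R]_p,
  {in bs, forall B, generator E A B} & \dim <<bs>>%VS = k >].
have exP : exists k, P k by exists (\dim <<[::] : seq 'M[R]_p>>%VS); apply/asboolP; exists [::].
have bP k : P k -> (k <= \dim (fullv : {vspace 'M[R]_p}))%N.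
  by move=> /asboolP[bs _ <-]; exact/dimvS/subvf.
have [k /asboolP[bs gbs dk] kmax] := ex_maxnP exP bP.
exists bs => // W hW B gB.
have : B \in <<bs>>%VS.
  have sub : (<<bs>> <= <<B :: bs>>)%VS by rewrite span_cons addvSr.
  have : (\dim <<B :: bs>> <= \dim <<bs>>)%N.
    rewrite dk; apply: kmax; apply/asboolP; exists (B :: bs) => // B'.
    by rewrite in_cons => /predU1P[->//|]; exact: gbs.
  rewrite (geq_leqif (dimv_leqif_sup sub)) => /subvP; apply.
  by rewrite memv_span // in_cons eqxx.
move=> /(@coord_span _ _ _ (in_tuple bs)) ->.
rewrite tdotC /tdot mulmx_sumr raddf_sum big1 // => i _ /=.
rewrite -scalemxAr mxtraceZ -[\tr _]/(tdot W _) tdotC hW ?mulr0 //.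
by apply: mem_nth.
Qed.
End SemigroupReach.

HB.instance Definition _ (R : realType) (p q : nat) := Complete.on 'M[R]_(p, q).

(** * Interior points of the semigroup and its closedness *)

Section SemigroupClosed.
Variables (R : realType) (p : nat) (I : Type).
Variables (E : I -> R -> 'M[R]_p) (A : I -> 'M[R]_p).
Hypothesis ED : forall i s t, E i (s + t) = E i s *m E i t.
Hypothesis Eorth : forall i t, (E i t)^T *m E i t = 1%:M.
Hypothesis Ediff : forall i (e : R), 0 < e -> exists2 dl : R, 0 < dl &
  forall t, `|t| <= dl -> `|E i t - 1%:M - t *: A i| <= e * `|t|.

Local Notation S := (semigrp E).
Local Notation K := (semigrp_cl E).

(** A solution of [psi Z = g] is a fixed point of [Z - psi Z + g], a contraction with factor one
    half. It maps the ball of radius [r] to itself because [r / 2] comes from the contraction and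
    [r / 2] from [|g - psi 0|]. *)
Lemma near_id_surj (r : R) (psi : 'M[R]_p -> 'M[R]_p) : 0 < r ->
  (forall Z Z' : 'M[R]_p, `|Z| <= r -> `|Z'| <= r ->
    `|psi Z - psi Z' - (Z - Z')| <= 2^-1 * `|Z - Z'|) ->
  forall g : 'M[R]_p, `|g - psi 0| <= r / 2 -> exists2 Z : 'M[R]_p, `|Z| <= r & psi Z = g.
Proof.
move=> r0 hpsi g hg.
pose U := [set Z : 'M[R]_p | `|Z| <= r].
pose h (Z : 'M[R]_p) : 'M[R]_p := Z - psi Z + g.
have Uh : isFun _ _ U U h.
  constructor => Z /= hZ; rewrite /U /= /h.
  have -> : Z - psi Z + g = - (psi Z - psi 0 - (Z - 0)) + (g - psi 0).
    by rewrite subr0; apply/matrixP => i j; rewrite !mxE; ring.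
  rewrite (le_trans (ler_normD _ _)) // normrN.
  have h0 := hpsi Z 0 hZ; rewrite normr0 subr0 in h0.
  have {}h0 := h0 (ltW r0).
  by have {}hZ : `|Z| <= r := hZ; rewrite subr0; lra.
pose hF : {fun U >-> U} := HB.pack h Uh.
have [|||Z UZ hZ] := @banach_fixed_point R _ U hF.
- exists (2^-1)%:nng; split => /=; first by rewrite invf_lt1 // ltr1n.
  move=> [Z Z'] [/= UZ UZ']; rewrite /h.
  have -> : Z - psi Z + g - (Z' - psi Z' + g) = - (psi Z - psi Z' - (Z - Z')).
    by apply/matrixP => i j; rewrite !mxE; ring.
  by rewrite normrN; exact: hpsi.
- rewrite (_ : U = (fun x => `|x|) @^-1` [set y : R | y <= r]) //.
  by apply: closed_comp; [move=> x _; exact: norm_continuous|exact: closed_le].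
- by exists 0; rewrite /U /= normr0 ltW.
exists Z => //; move/eqP: hZ; rewrite /= /h -subr_eq0 => /eqP hZ.
apply/eqP; rewrite -subr_eq0; apply/eqP; rewrite -[RHS]hZ.
by apply/matrixP => i j; rewrite !mxE; ring.
Qed.

(* Writing [Z = L Z + eta Z], with [L Z] in the span of the generators and
   [eta Z] normal to it, [L] is matched by a map [f] into [S], so
   [Z |-> f Z (1 + eta Z)] is onto a neighbourhood of [f 0]. On [K] the factor
   [1 + eta Z] must be the identity, hence [S] has interior points in [K]; as
   [S] is dense in [K], they can be translated to any point of [K]. *)
Theorem semigrp_closed (rho : R) : 0 < rho ->
  (forall W, normal_vector E A W -> `|W| <= rho -> K (1%:M + W) -> W = 0) ->
  forall k, K k -> S k.
Proof.
move=> rho0 hW.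
have [bs gbs nbs] := generator_finite_span E A.
have [L [rL L0 nL _]] := realizable_projection_seq ED Eorth Ediff gbs.
have nW Z : normal_vector E A (Z - L Z).
  by move=> B gB; rewrite tdotC; apply: nbs => // B' B'b; exact: nL.
have [lL hL] := rL; have [C C0 hC] := lL.
pose eta (Z : 'M[R]_p) := Z - L Z.
have heta Z Z' : `|eta Z - eta Z'| <= (1 + C) * `|Z - Z'|.
  rewrite /eta opprD addrACA -opprD (le_trans (ler_normB _ _)) //.
  by rewrite mulrDl mul1r lerD2l.
have leta : lipschitz_mx eta by exists (1 + C) => //; rewrite addr_ge0.
have h2 : 0 < 2^-1 :> R by rewrite invr_gt0.
have [e e0 hM] := near_affineM lL leta h2.
have [r1 r10 [f nf Sf]] := hL e e0.
have C1 : 0 < 1 + C by rewrite ltr_pwDl.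
(* The three bounds serve, in order, the approximation [f], the requirement that [1 + eta Z] be
   within [e] of the identity, and the radius [rho] on which normal displacements in [K] vanish. *)
pose r := Order.min r1 (Order.min (e / (1 + C)) (rho / (1 + C))).
have r0 : 0 < r by rewrite !lt_min r10 !divr_gt0.
have rr1 : r <= r1 by rewrite ge_min lexx.
have re : (1 + C) * r <= e.
  by rewrite mulrC -ler_pdivlMr // ge_min ge_min lexx orbT.
have rrho : (1 + C) * r <= rho.
  by rewrite mulrC -ler_pdivlMr // ge_min ge_min lexx !orbT.
have etab Z : `|Z| <= r -> `|eta Z| <= (1 + C) * r.
  move=> hZ; have := heta Z 0; rewrite {2}/eta L0 !subr0 => /le_trans; apply.
  by rewrite ler_wpM2l // ltW.
have neta : near_affine e r eta (fun Z => 1%:M + eta Z).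
  move=> Z Z' hZ _; split.
    by rewrite addrC addKr (le_trans (etab Z hZ)).
  rewrite (_ : _ - _ = 0); first by rewrite normr0 mulr_ge0 // ltW.
  by apply/matrixP => i j; rewrite !mxE; ring.
have hpsi := hM _ _ _ (near_affineW rr1 nf) neta.
pose psi Z := f Z *m (1%:M + eta Z).
have {}hpsi (Z Z' : 'M[R]_p) : `|Z| <= r -> `|Z'| <= r ->
    `|psi Z - psi Z' - (Z - Z')| <= 2^-1 * `|Z - Z'|.
  by move=> hZ hZ'; have [_] := hpsi Z Z' hZ hZ'; rewrite /eta ![L _ + _]addrC !subrK.
have hsurj := near_id_surj r0 hpsi.
have psi0 : psi 0 = f 0 by rewrite /psi /eta L0 subr0 addr0 mulmx1.
rewrite psi0 in hsurj.
have hr0 : `|0 : 'M[R]_p| <= r1 by rewrite normr0 ltW.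
have SK (g : 'M[R]_p) : K g -> `|g - f 0| <= r / 2 -> S g.
  move=> Kg /hsurj[Z hZ eg].
  have SfZ : S (f Z) by apply: Sf; exact: le_trans rr1.
  suff W0 : eta Z = 0 by rewrite -eg /psi W0 addr0 mulmx1.
  apply: hW; [exact: nW|exact: le_trans (etab Z hZ) rrho|].
  have -> : 1%:M + eta Z = (f Z)^T *m g.
    by rewrite -eg /psi mulmxA (semigrp_orth Eorth SfZ) mul1mx.
  by apply: semigrp_cl_mul => //; apply: semigrp_cl_tr => //; exact: semigrp_clW.
(* Density yields [s] in [S] close to [k (f 0)^T]. Then [s^T k] is in [K] and within [r / 2] of
   [f 0], hence in [S], and [k = s (s^T k)]. *)
move=> k Kk; have S0 := Sf 0 hr0.
have K0 : K (k *m (f 0)^T).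
  by apply: semigrp_cl_mul => //; apply: semigrp_cl_tr => //; exact: semigrp_clW.
pose M : R := p%:R * p%:R + 1; have M0 : 0 < M by rewrite ltr_wpDl // mulr_ge0.
have [s Ss ks] := K0 (r / 2 / M) (divr_gt0 (divr_gt0 r0 (ltr0n _ 2)) M0).
have os := semigrp_orth Eorth Ss; have o0 := semigrp_orth Eorth S0.
rewrite -[k]mul1mx -(orthomxC os) -mulmxA; apply: semigrp_mul => //; apply: SK.
  by apply: semigrp_cl_mul => //; apply: semigrp_cl_tr => //; exact: semigrp_clW.
have -> : s^T *m k - f 0 = s^T *m (k *m (f 0)^T - s) *m f 0.
  by rewrite !(mulmxBr, mulmxBl) os mul1mx -!mulmxA o0 mulmx1.
have s1 := mx_norm_row os; rewrite -mx_norm_tr in s1.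
rewrite (le_trans (mx_normMle (mx_normMle s1 ks) (mx_norm_row o0))) //.
rewrite !mulr1 mulrA; apply: (@le_trans _ _ (M * (r / 2 / M))).
  by rewrite ler_wpM2r ?lerDl // !divr_ge0 // ltW.
by rewrite mulrC divfK // gt_eqF.
Qed.

(** If no [rho] satisfies the hypothesis of [semigrp_closed], there are nonzero normal [w n] tending
    to zero with [1 + w n] in [K]. A cluster point of the unit vectors [w n / |w n|] is tangent,
    normal and nonzero. *)
Theorem semigrp_closed_or_normal_tangent :
  (forall k, K k -> S k) \/
  exists X, [/\ X != 0, tangent E X, normal_vector E A X &
    forall i, X *m A i = A i *m X].
Proof.
have [[rho rho0 /semigrp_closed h]|hno] := pselect (exists2 rho : R, 0 < rho &
  forall W, normal_vector E A W -> `|W| <= rho -> K (1%:M + W) -> W = 0).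
  by left; exact: h.
right.
have hW n : exists W, [/\ normal_vector E A W, `|W| <= n.+1%:R^-1,
    K (1%:M + W) & W != 0].
  apply: contrapT => hn; apply: hno; exists n.+1%:R^-1 => // W nW Wn KW.
  by apply/eqP/negPn/negP => W0; apply: hn; exists W.
have [w hw] := choice hW.
have w0 n : 0 < `|w n| by rewrite normr_gt0; have [] := hw n.
pose Y n := `|w n|^-1 *: w n.
have Y1 n : `|Y n| = 1.
  by rewrite normrZ normfV normr_id mulVf // gt_eqF.
have [X hX] : exists X, forall (e : R) N, 0 < e ->
    exists2 n, (N <= n)%N & `|Y n - X| <= e.
  by apply: (@bounded_mx_cluster _ _ _ _ 1) => n; rewrite Y1.
have nX : normal_vector E A X.
  move=> B gB; apply: (@eq0_le_eps _ _ _ (p%:R * p%:R * `|B|)) => e e0 e1.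
  have [n _ hn] := hX e 0%N e0.
  have -> : tdot X B = tdot (X - Y n) B.
    have [nw _ _ _] := hw n.
    by rewrite tdotBl tdotZl nw // mulr0 subr0.
  rewrite (le_trans (tdot_bound _ _)) // mulrAC ler_wpM2l // ?mulr_ge0 //.
  by rewrite distrC.
have tX : tangent E X.
  move=> e e0; have [N hN] : exists N, N.+1%:R^-1 <= e.
    have [N hN] := ltr_add_invr e0.
    by exists N; move: hN; rewrite add0r => /ltW.
  have [n Nn hn] := hX e N e0; have [_ wn Kw _] := hw n.
  exists `|w n|, (Y n); split => //.
    rewrite (le_trans wn) // (le_trans _ hN) // lef_pV2 ?posrE ?ltr0n //.
    by rewrite ler_nat ltnS.
  by rewrite /Y scalerA divff ?scale1r // gt_eqF.
exists X; split=> //.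
  apply/negP => /eqP X0; have [|n _] := hX 2^-1 0%N; first by rewrite invr_gt0.
  by rewrite X0 subr0 Y1; apply/negP; rewrite -ltNge invf_lt1 // ltr1n.
move=> i; apply: (normal_tangent_comm Eorth Ediff tX nX).
exists 1%:M, i; first exact: semigrp_cl1.
by rewrite trmx1 mul1mx mulmx1.
Qed.
End SemigroupClosed.

(** * Integral curves *)

Lemma is_derive_near (R : realType) (f : R -> R) (x df e : R) :
  is_derive x 1 f df -> 0 < e -> exists2 dl : R, 0 < dl &
    forall h, `|h| <= dl -> `|f (x + h) - f x - h * df| <= e * `|h|.
Proof.
move=> [hf hdf] e0.
have hc : h^-1 *: ((f \o shift x) (h *: 1) - f x) @[h --> 0^'] --> df.
  by rewrite -hdf; exact: hf.
move/cvgrPdist_le: hc => /(_ _ e0); rewrite /dnbhs near_withinE => hn.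
have [d /= d0 hd] := (@nbhs_ballP R R _ _).1 hn.
exists (d / 2) => [|h hdl]; first exact: divr_gt0.
have [->|hn0] := eqVneq h 0; first by rewrite addr0 subrr mul0r subr0 normr0 mulr0.
have hd2 : `|h| < d by lra.
have /= := hd h _ hn0; rewrite /ball /= sub0r normrN => /(_ hd2).
rewrite /shift /= [h *: 1]mulr1 (addrC h).
set D := f _ - _ => hD.
have -> : D - h * df = - (h * (df - h^-1 *: D)).
  by rewrite mulrBr -[_ *: D]/(_ * D) mulrA divff // mul1r opprB.
by rewrite normrN normrM mulrC ler_pM2r // normr_gt0.
Qed.

Section IntegralCurves.
Variable R : realType.
Local Notation mu := (@lebesgue_measure R).

(** Real induction: the supremum of the times where [P] holds is attained by left-closedness, and a
    positive step to the right would exceed it unless it is [T]. *)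
Lemma right_induction (T : R) (P : R -> Prop) : 0 <= T -> P 0 ->
  (forall t, 0 <= t <= T ->
    (forall dl : R, 0 < dl -> exists2 s, t - dl < s <= t & 0 <= s /\ P s) -> P t) ->
  (forall t, 0 <= t < T -> P t -> exists2 dl : R, 0 < dl &
    forall h, 0 <= h <= dl -> t + h <= T -> P (t + h)) ->
  P T.
Proof.
move=> T0 P0 hcl hst.
pose B := [set t | 0 <= t <= T /\ P t].
have B0 : B 0 by split=> //; rewrite lexx.
have ubB : ubound B T by move=> t [/andP[]].
have hB : has_sup B by split; [exists 0|exists T].
pose t := sup B.
have t0 : 0 <= t by apply: ub_le_sup => //; exists T.
have tT : t <= T by apply: ge_sup => //; exists 0.
have Pt : P t.
  apply: hcl => [|dl dl0]; first by rewrite t0.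
  have [s [/andP[s0 sT] Ps] ts] := sup_adherent dl0 hB.
  exists s => //; rewrite ts /=; apply: ub_le_sup; first by exists T.
  by split=> //; rewrite s0.
have [<-//|tT'] := eqVneq t T.
have [|dl dl0 hdl] := hst t _ Pt; first by rewrite t0 lt_neqAle tT' tT.
pose h := Order.min dl (T - t).
have h0 : 0 < h by rewrite lt_min dl0 subr_gt0 lt_neqAle tT' tT.
have hT : t + h <= T by rewrite addrC -lerBrDr ge_min lexx orbT.
have : t + h <= t.
  apply: ub_le_sup; first by exists T.
  split; first by rewrite hT addr_ge0 // ltW.
  by apply: hdl => //; rewrite (ltW h0) ge_min lexx.
by rewrite gerDl leNgt h0.
Qed.

Lemma lebesgue_itv_oc (s t : R) : s <= t -> mu `]s, t] = (t - s)%:E.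
Proof.
move=> st; rewrite lebesgue_measure_itv /= lte_fin -EFinB.
by case: ltP => // ts; have -> : t = s; [exact/le_anti/andP|rewrite subrr].
Qed.

Section Primitive.
Variables (K : finType) (f : K -> R -> R).
Hypothesis intf : forall k, mu.-integrable setT (EFin \o f k).

Definition primitive k (t : R) : R := \int[mu]_(x in `[0, t]) f k x.

Let intfS k (D : set R) : measurable D -> mu.-integrable D (EFin \o f k).
Proof. by move=> mD; apply: integrableS (intf k). Qed.

Lemma primitiveB k s t : 0 <= s -> s <= t ->
  primitive k t - primitive k s = \int[mu]_(x in `]s, t]) f k x.
Proof.
move=> s0 st; rewrite /primitive Rintegral_itvB ?bnd_simp //.
by apply: intfS.
Qed.

Lemma primitive_cont k (e : R) : 0 < e -> exists2 dl : R, 0 < dl &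
  forall s t : R, 0 <= s -> s <= t -> t - s < dl ->
    `|primitive k t - primitive k s| <= e.
Proof.
move=> e0; have [dl [dl0 hdl]] := integral_normr_continuous (intf k) e0.
exists dl => // s t s0 st ts; rewrite primitiveB //.
rewrite (le_trans (le_normr_Rintegral _ _)) //; first exact: intfS.
apply/ltW/hdl => //; suff : (mu `]s, t] < dl%:E)%E by [].
by rewrite lebesgue_itv_oc // lte_fin.
Qed.

Lemma primitive_ae_derivative (e : R) : 0 < e ->
  {ae mu, forall t, 0 <= t -> exists2 dl : R, 0 < dl &
    forall h, 0 <= h <= dl -> forall k,
      `|primitive k (t + h) - primitive k t - h * f k t| <= e * h}.
Proof.
move=> e0.
have hk k : {ae mu, forall t, (0%:E < t%:E)%E ->
    derivable (primitive k) t 1 /\ (primitive k)^`() t = f k t}.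
  have := @FTC1 R (f k) (BLeft 0) (fun y => intfS k (measurable_itv _)).
  by move/(_ (open_integrable_locally openT (intf k))).
(* Differentiation of the primitive is available only at [t > 0], so the left endpoint joins the
   exceptional null set. *)
have hne : {ae mu, forall t : R, t != 0}.
  exists [set 0]; split; [exact: measurable_set1|exact: lebesgue_measure_set1|].
  by move=> t /= /negP; rewrite negbK => /eqP.
have FF : Filter (almost_everywhere mu) := ae_filter_ringOfSetsType mu.
have {}hk := filter_forall FF hk.
apply: filterS2 hne hk => t tn0 ht t0.
have {ht} hd k : exists2 dl : R, 0 < dl & forall h, 0 <= h <= dl ->
    `|primitive k (t + h) - primitive k t - h * f k t| <= e * h.
  have [|dF eF] := ht k; first by rewrite lte_fin lt_neqAle eq_sym tn0.
  have dk : is_derive t 1 (primitive k) (f k t) 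
    by apply: DeriveDef; [exact: dF|rewrite -derive1E; exact: eF].
  have [dl dl0 hdl] := is_derive_near dk e0; exists dl => // h /andP[h0 hd].
  by have := hdl h; rewrite ger0_norm //; exact.
have [g hg] := choice (fun k => let: ex_intro2 x p q := hd k in ex_intro _ x (conj p q)).
exists (\big[Order.min/1]_k g k).
  by apply: lt_bigmin => // k _; have [] := hg k.
move=> h /andP[h0 hle] k; have [_] := hg k; apply; rewrite h0 /=.
by apply: le_trans hle _; exact: bigmin_le.
Qed.

Lemma sum_Rintegral_norm (D : set R) : measurable D ->
  \sum_k \int[mu]_(x in D) `|f k x| = \int[mu]_(x in D) \sum_k `|f k x|.
Proof.
move=> mD; elim: (index_enum K) => [|k s IH].
  under eq_Rintegral do rewrite big_nil.
  by rewrite big_nil Rintegral_cst // mul0r.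
under eq_Rintegral do rewrite big_cons.
rewrite big_cons IH RintegralD //.
  by apply: integrable_norm => //; exact: intfS.
rewrite (_ : EFin \o _ = fun x => (\sum_(k <- s) (`|f k x|%R)%:E)%E).
  by apply: integrable_sum => // l _; apply: integrable_norm => //; exact: intfS.
by apply/funext => x; rewrite /= sumEFin.
Qed.

(* [b] bounds the variation near the exceptional null set: it is the integral
   of [\sum_k |f k|] over a small open neighbourhood of that set. *)
Lemma primitive_increments (e : R) : 0 < e ->
  exists b : R -> R, [/\ forall t, b t <= e,
    forall s t : R, 0 <= s -> s <= t -> b s <= b t, 0 <= b 0 &
    forall t, 0 <= t -> exists2 dl : R, 0 < dl & forall h, 0 <= h <= dl ->
      (forall k, `|primitive k (t + h) - primitive k t - h * f k t| <= e * h) \/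
      \sum_k `|primitive k (t + h) - primitive k t| <= b (t + h) - b t].
Proof.
move=> e0; pose phi x := \sum_k `|f k x|.
have iphi : mu.-integrable setT (EFin \o phi).
  rewrite (_ : EFin \o phi = fun x => (\sum_k (`|f k x|%R)%:E)%E).
    by apply: integrable_sum => // k _; exact: integrable_norm.
  by apply/funext => x; rewrite /= sumEFin.
have phi0 x : 0 <= phi x by exact: sumr_ge0.
(* Absolute continuity of the integral: any set of measure below [dl] carries less than [e] of the
   total variation. Outer regularity then provides such an open set around the null set. *)
have [dl [dl0 hdl]] := integral_normr_continuous iphi e0.
have [N [mN N0 subN]] := primitive_ae_derivative e0.
have {}N0 : mu N = 0%E := N0.
have muN : (mu N < +oo)%E by rewrite N0 ltry.
have [V [oV NV muV]] := @lebesgue_regularity_outer R N dl mN muN dl0.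
have mV : measurable V by exact: measurable_realfun.open_measurable.
have mu_V : (mu V < dl%:E)%E.
  rewrite (le_lt_trans _ muV) //.
  apply: (@le_trans _ _ (mu (N `|` V `\` N))).
    by apply: le_measure; rewrite ?setDUK //; exact: mem_set.
  apply: le_trans (measureU2 _ _ _) _ => //; first exact: measurableD.
  by rewrite [X in (X + _)%E]N0 add0e.
have iS (D : set R) : measurable D -> mu.-integrable D (EFin \o phi).
  by move=> mD; apply: integrableS iphi.
pose b t := \int[mu]_(x in `[0, t] `&` V) phi x.
have bD s t : 0 <= s -> s <= t -> b t = b s + \int[mu]_(x in `]s, t] `&` V) phi x.
  move=> s0 st; rewrite /b -Rintegral_setU; first last.
  - apply/disj_setPS => y [[/= + _] [/= + _]]; rewrite !in_itv /=.
    by move=> /andP[_ ys] /andP[]; rewrite ltNge ys.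
  - by apply: iS; apply: measurableU; exact: measurableI.
  - exact: measurableI.
  - exact: measurableI.
  rewrite -setIUl; congr (\int[mu]_(x in _ `&` V) phi x).
  by rewrite -itv_bndbnd_setU // bnd_simp.
exists b; split.
- move=> t; apply: ltW.
  rewrite /b (_ : \int[mu]_(_ in _) _ = \int[mu]_(x in `[0, t] `&` V) `|phi x|).
    apply: hdl; first exact: measurableI.
    by apply: le_lt_trans mu_V; apply: le_measure => //; apply: mem_set => //; exact: measurableI.
  by apply: eq_Rintegral => x _; rewrite ger0_norm.
- by move=> s t s0 st; rewrite (bD s t) // lerDl Rintegral_ge0.
- exact: Rintegral_ge0.
move=> t t0; have [tN|tN] := pselect (N t); last first.
  have [d d0 hd] : exists2 d : R, 0 < d & forall h, 0 <= h <= d -> forall k,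
      `|primitive k (t + h) - primitive k t - h * f k t| <= e * h.
    by apply: contrapT => h; apply: tN; apply: subN => /= h'; exact/h/h'.
  by exists d => // h /hd ?; left.
have /(nbhs_ballP _ _)[d /= d0 hd] : nbhs t V by exact: open_nbhs_nbhs (conj oV (NV _ tN)).
exists (d / 2) => [|h /andP[h0 hdl']]; first exact: divr_gt0.
right; have tth : t <= t + h by rewrite lerDl.
rewrite (bD t (t + h)) // [leRHS]addrC addKr setIidl; last first.
  move=> x /=; rewrite in_itv /= => /andP[tx xt]; apply: hd.
  by rewrite /ball /= distrC ger0_norm ?subr_ge0 ?(ltW tx) //; lra.
rewrite (le_trans (y := \sum_k \int[mu]_(x in `]t, t + h]) `|f k x|)) //.
  apply: ler_sum => k _; rewrite primitiveB // le_normr_Rintegral //.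
  exact: intfS.
by rewrite /phi sum_Rintegral_norm.
Qed.
End Primitive.
End IntegralCurves.

(** * Integral curves and the closure of the semigroup *)

Section SemigroupCurves.
Variables (R : realType) (p q : nat) (I : Type).
Variables (E : I -> R -> 'M[R]_p) (A : I -> 'M[R]_p).
Hypothesis Eorth : forall i t, (E i t)^T *m E i t = 1%:M.
Hypothesis Ediff : forall i (e : R), 0 < e -> exists2 dl : R, 0 < dl &
  forall t, `|t| <= dl -> `|E i t - 1%:M - t *: A i| <= e * `|t|.
Local Notation mu := (@lebesgue_measure R).
Local Notation S := (semigrp E).

(* The distance from [x t] to the orbit of [x 0] has zero right derivative
   almost everywhere, because [E i] acts by isometries. *)
Theorem semigrp_integral_curve (x f : R -> 'M[R]_(p, q)) (T : R) : 0 <= T ->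
  (forall i j, mu.-integrable `[0, T] (EFin \o (fun t => f t i j))) ->
  (forall t : R, 0 <= t <= T -> forall i j,
    x t i j = x 0 i j + \int[mu]_(s in `[0, t]) f s i j) ->
  (forall t : R, 0 <= t <= T -> exists k, f t = A k *m x t) ->
  forall e : R, 0 < e -> exists2 s, S s & `|x T - s *m x 0| <= e.
Proof.
move=> T0 intf hx hf e e0.
(* Extended by zero because the estimates on primitives are for functions integrable on the whole
   line. *)
pose f0 (ij : 'I_p * 'I_q) (t : R) : R := if t \in `[0, T]%R then f t ij.1 ij.2 else 0.
have intf0 ij : mu.-integrable setT (EFin \o f0 ij).
  have := intf ij.1 ij.2; rewrite integrable_mkcond //=.
  congr (mu.-integrable setT _); apply/funext => t; rewrite patchE /f0 /=.
  by rewrite mem_setE; case: ifP.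
have f0E t ij : 0 <= t <= T -> f0 ij t = f t ij.1 ij.2.
  by rewrite /f0 in_itv /= => ->.
have xF t i j : 0 <= t <= T -> x t i j = x 0 i j + primitive f0 (i, j) t.
  move=> tT; rewrite hx //; congr (_ + _); apply: eq_Rintegral => s.
  rewrite inE /= in_itv /= => /andP[s0 st]; rewrite f0E // s0.
  by case/andP: tT => _; exact: le_trans.
pose pq : R := p%:R * q%:R.
have pq0 : 0 <= pq by exact: mulr_ge0.
have T1 : 0 < (pq + 1) * T + 2 by rewrite ltr_wpDl // mulr_ge0 // addr_ge0.
(* The final error is [(pq + 1) d T] from the good times, at most [d] from [b T], and a slack of
   [d], which add up to at most [e]. *)
pose d := e / ((pq + 1) * T + 2); have d0 : 0 < d by exact: divr_gt0.
have pqd0 : 0 <= (pq + 1) * d by apply: mulr_ge0; [exact: addr_ge0|exact: ltW].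
have [b [bd bmon b0 hb]] := primitive_increments intf0 d0.
have xB t h i j : 0 <= t -> 0 <= h -> t + h <= T ->
    x (t + h) i j - x t i j = primitive f0 (i, j) (t + h) - primitive f0 (i, j) t.
  move=> t0 h0 th; have tT : t <= T by apply: le_trans th; rewrite lerDl.
  by rewrite (xF (t + h)) ?(xF t) ?t0 ?th ?tT ?addr_ge0 //; ring.
(* The slack [n] is arbitrary but kept fixed during a step to the right; it makes [P] closed from
   the left, where half of it pays for the continuity of [x]. *)
pose P t := forall n : R, 0 < n -> exists2 s, S s &
  fnorm (x t - s *m x 0) <= (pq + 1) * d * t + b t + n.
suff /(_ d d0) [s Ss hs] : P T.
  exists s => //; rewrite (le_trans (le_fnorm _)) // (le_trans hs) //.
  have -> : e = ((pq + 1) * T + 2) * d by rewrite mulrC divfK // gt_eqF.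
  have := bd T; rewrite -subr_ge0 => hbT; rewrite -subr_ge0.
  by rewrite (_ : _ - _ = d - b T) //; ring.
apply: (right_induction T0).
- move=> n n0; exists 1%:M; first exact: semigrp1.
  rewrite mul1mx subrr /fnorm tdot0r sqrtr0 mulr0 add0r.
  by rewrite addr_ge0 // ltW.
- move=> t /andP[t0 tT] hl n n0.
  have npos : 0 < n / 2 / (pq + 1) by rewrite !divr_gt0 // ltr_wpDl.
  have hc ij : exists dl : R, 0 < dl /\ forall s t' : R, 0 <= s -> s <= t' -> t' - s < dl ->
      `|primitive f0 ij t' - primitive f0 ij s| <= n / 2 / (pq + 1).
    by have [dl dl0 hdl] := primitive_cont intf0 ij npos; exists dl.
  have [g hg] := choice hc.
  pose dl := \big[Order.min/1]_ij g ij.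
  have dl0 : 0 < dl by apply: lt_bigmin => // ij _; have [] := hg ij.
  have [s /andP[ts st] [s0 Ps]] := hl dl dl0.
  have [sg Ssg hsg] := Ps (n / 2) (divr_gt0 n0 (ltr0n _ 2)).
  exists sg => //.
  have -> : x t - sg *m x 0 = (x t - x s) + (x s - sg *m x 0) by rewrite addrA subrK.
  rewrite (le_trans (ler_fnormD _ _)) //.
  have hxx : fnorm (x t - x s) <= n / 2.
    rewrite (le_trans (fnorm_le _)) // -/pq.
    have : `|x t - x s| <= n / 2 / (pq + 1).
      apply: mx_norm_le => [|i j]; first exact: ltW.
      have := xB s (t - s) i j s0; rewrite (addrC s) subrK subr_ge0 => /(_ st tT) hB.
      rewrite !mxE hB; have [_] := hg (i, j); apply=> //.
      by apply: (@lt_le_trans _ _ dl); [lra|exact: bigmin_le].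
    rewrite ler_pdivlMr ?ltr_wpDl // => h; apply: le_trans h.
    by rewrite mulrC ler_wpM2l // lerDl.
  rewrite (le_trans (lerD hxx hsg)) //.
  have h1 : (pq + 1) * d * s <= (pq + 1) * d * t.
    by rewrite ler_wpM2l // mulr_ge0 ?addr_ge0 // ltW.
  have h2 := bmon _ _ s0 st.
  by move: h1 h2; set u := (pq + 1) * d * s; set v := (pq + 1) * d * t; lra.
move=> t /andP[t0 tT] Pt; have [dl dl0 hdl] := hb t t0.
have tT' : 0 <= t <= T by rewrite t0 ltW.
have [k hk] := hf t tT'.
(* Dividing the tolerance by [M] compensates for the size of [x t]. The admissible step length may
   depend on [t], as [right_induction] allows. *)
pose M := pq * (p%:R * `|x t|) + 1.
have M0 : 0 < M by rewrite ltr_wpDl // !mulr_ge0.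
have dM0 : 0 < d / M by exact: divr_gt0.
have [d1 d10 hd1] := Ediff k dM0.
exists (Order.min dl d1); first by rewrite lt_min dl0.
move=> h /andP[h0 hmin] hT n n0; have [sg Ssg hsg] := Pt n n0.
have hdl' : 0 <= h <= dl by rewrite h0 (le_trans hmin) // ge_min lexx.
have hd1' : `|h| <= d1 by rewrite ger0_norm // (le_trans hmin) // ge_min lexx orbT.
have bth : b t <= b (t + h) by apply: bmon => //; rewrite lerDl.
have {hdl}[hgood|hbad] := hdl h hdl'; last first.
  (* Near the exceptional set the semigroup element stays put: the motion of [x] itself is paid for
     by the increment of [b]. *)
  exists sg => //.
  have -> : x (t + h) - sg *m x 0 = (x (t + h) - x t) + (x t - sg *m x 0).
    by rewrite addrA subrK.
  have hxx : fnorm (x (t + h) - x t) <= b (t + h) - b t.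
    rewrite (le_trans (fnorm_le_sum _)) //; apply: le_trans hbad.
    by apply: ler_sum => -[i j] _ /=; rewrite !mxE xB.
  rewrite (le_trans (ler_fnormD _ _)) // (le_trans (lerD hxx hsg)) //.
  rewrite -subr_ge0 (_ : _ - _ = (pq + 1) * d * h); last by ring.
  exact: mulr_ge0.
exists (E k h *m sg); first exact: semigrpE.
have -> : x (t + h) - E k h *m sg *m x 0 =
    (x (t + h) - x t - h *: f t) - (E k h - 1%:M - h *: A k) *m x t
    + E k h *m (x t - sg *m x 0).
  rewrite hk !(mulmxBl, mulmxBr, mul1mx) -scalemxAl mulmxA.
  by apply/matrixP => i j; rewrite !mxE; ring.
have h1 : fnorm (x (t + h) - x t - h *: f t) <= pq * (d * h).
  rewrite (le_trans (fnorm_le _)) // ler_wpM2l //.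
  apply: mx_norm_le => [|i j]; first by rewrite mulr_ge0 // ltW.
  by have := hgood (i, j); rewrite !mxE xB // f0E.
have h2 : fnorm (- ((E k h - 1%:M - h *: A k) *m x t)) <= d * h.
  rewrite (le_trans (fnorm_le _)) // normrN -/pq.
  rewrite (le_trans (ler_wpM2l pq0 (mx_normMle (hd1 _ hd1') (lexx _)))) //.
  rewrite ger0_norm //.
  have -> : pq * (p%:R * (d / M * h) * `|x t|) = pq * (p%:R * `|x t|) * (d / M * h).
    by ring.
  rewrite (le_trans (y := M * (d / M * h))) //.
    by rewrite ler_wpM2r ?lerDl // mulr_ge0 // ltW.
  by rewrite mulrA mulrCA divff ?mulr1 // gt_eqF.
rewrite (le_trans (ler_fnormD _ _)) // fnorm_orth //.
rewrite (le_trans (lerD (le_trans (ler_fnormD _ _) (lerD h1 h2)) hsg)) //.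
rewrite -subr_ge0 (_ : _ - _ = b (t + h) - b t); last by ring.
by rewrite subr_ge0.
Qed.
End SemigroupCurves.

(** * Realification and Hermitian flows *)

Section Realification.
Variable R : realType.
Local Notation C := R[i].
Local Notation Re := (@complex.Re R).
Local Notation Im := (@complex.Im R).

Lemma cReD (x y : C) : Re (x + y) = Re x + Re y. Proof. by case: x y => ? ? []. Qed.
Lemma cImD (x y : C) : Im (x + y) = Im x + Im y. Proof. by case: x y => ? ? []. Qed.
Lemma cReN (x : C) : Re (- x) = - Re x. Proof. by case: x. Qed.
Lemma cImN (x : C) : Im (- x) = - Im x. Proof. by case: x. Qed.
Lemma cReM (x y : C) : Re (x * y) = Re x * Re y - Im x * Im y.
Proof. by case: x y => ? ? []. Qed.
Lemma cImM (x y : C) : Im (x * y) = Re x * Im y + Im x * Re y.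
Proof. by case: x y => ? ? [? ?] /=. Qed.
Lemma cRe_conj (x : C) : Re (Num.conj x) = Re x. Proof. by case: x. Qed.
Lemma cIm_conj (x : C) : Im (Num.conj x) = - Im x. Proof. by case: x. Qed.
Lemma cRe_nat (b : bool) : Re (b%:R : C) = b%:R. Proof. by case: b. Qed.
Lemma cIm_nat (b : bool) : Im (b%:R : C) = 0. Proof. by case: b. Qed.
Lemma cRe_sum (I : Type) (s : seq I) (P : pred I) (F : I -> C) :
  Re (\sum_(i <- s | P i) F i) = \sum_(i <- s | P i) Re (F i).
Proof. exact: (big_morph Re cReD). Qed.
Lemma cIm_sum (I : Type) (s : seq I) (P : pred I) (F : I -> C) :
  Im (\sum_(i <- s | P i) F i) = \sum_(i <- s | P i) Im (F i).
Proof. exact: (big_morph Im cImD). Qed.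
Lemma complex_eq (x y : C) : Re x = Re y -> Im x = Im y -> x = y.
Proof. by case: x y => ? ? [? ?] /= -> ->. Qed.

Definition realify (n : nat) (A : 'M[C]_n) : 'M[R]_(n + n) :=
  block_mx (map_mx Re A) (- map_mx Im A) (map_mx Im A) (map_mx Re A).

Definition realcol (n p : nat) (X : 'M[C]_(n, p)) : 'M[R]_(n + n, p) :=
  col_mx (map_mx Re X) (map_mx Im X).

Lemma realifyM n (A B : 'M[C]_n) : realify (A *m B) = realify A *m realify B.
Proof.
rewrite /realify mulmx_block; congr block_mx; apply/matrixP => i j;
  rewrite !mxE ?(cRe_sum, cIm_sum) -?sumrN -big_split /=; apply: eq_bigr => k _;
  by rewrite !mxE (cReM, cImM); ring.
Qed.

Lemma realcolM n p (A : 'M[C]_n) (X : 'M[C]_(n, p)) :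
  realcol (A *m X) = realify A *m realcol X.
Proof.
rewrite /realify /realcol mul_block_col; congr col_mx; apply/matrixP => i j;
  rewrite !mxE ?(cRe_sum, cIm_sum) -big_split /=; apply: eq_bigr => k _;
  by rewrite !mxE (cReM, cImM); ring.
Qed.

Lemma realcolB n p (X Y : 'M[C]_(n, p)) : realcol (X - Y) = realcol X - realcol Y.
Proof.
rewrite /realcol opp_col_mx add_col_mx; congr col_mx; apply/matrixP => i j;
  by rewrite !mxE ?(cReD, cImD) ?(cReN, cImN).
Qed.

Lemma realify1 n : realify (1%:M : 'M[C]_n) = 1%:M.
Proof.
rewrite /realify scalar_mx_block; congr block_mx; apply/matrixP => i j;
  by rewrite !mxE ?(cRe_nat, cIm_nat) ?oppr0.
Qed.

Lemma realify_adj n (A : 'M[C]_n) : realify (adjmx A) = (realify A)^T.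
Proof.
rewrite /realify /adjmx tr_block_mx; congr block_mx; apply/matrixP => i j;
  by rewrite !mxE ?(cRe_conj, cIm_conj) ?opprK.
Qed.

Lemma realifyN n (A : 'M[C]_n) : realify (- A) = - realify A.
Proof.
rewrite /realify opp_block_mx; congr block_mx; apply/matrixP => i j;
  by rewrite !mxE ?(cReN, cImN).
Qed.

Lemma realify_inj n : injective (@realify n).
Proof.
move=> A B /eq_block_mx[/matrixP hRe _ /matrixP hIm _]; apply/matrixP => i j.
by apply: complex_eq; [have := hRe i j|have := hIm i j]; rewrite !mxE.
Qed.

Lemma realcol_inj n p : injective (@realcol n p).
Proof.
move=> A B /eq_col_mx[/matrixP hRe /matrixP hIm]; apply/matrixP => i j.
by apply: complex_eq; [have := hRe i j|have := hIm i j]; rewrite !mxE.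
Qed.

Lemma realify_norm n (A : 'M[C]_n) : `|realify A| <= `|realcol A|.
Proof.
have hRe i j : `|Re (A i j)| <= `|realcol A|.
  by have := le_mx_norm (realcol A) (lshift n i) j; rewrite col_mxEu mxE.
have hIm i j : `|Im (A i j)| <= `|realcol A|.
  by have := le_mx_norm (realcol A) (rshift n i) j; rewrite col_mxEd mxE.
apply: mx_norm_le => // i j; rewrite /realify.
by case: (split_ordP i) => i' ->; case: (split_ordP j) => j' ->;
  rewrite ?(block_mxEul, block_mxEur, block_mxEdl, block_mxEdr) !mxE ?normrN.
Qed.

Lemma realifyB n (A B : 'M[C]_n) : realify (A - B) = realify A - realify B.
Proof.
rewrite /realify opp_block_mx add_block_mx; congr block_mx; apply/matrixP => i j;
  by rewrite !mxE ?(cReD, cImD) ?(cReN, cImN) // opprD.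
Qed.

Lemma adjmxM n p q (A : 'M[C]_(n, p)) (B : 'M[C]_(p, q)) :
  adjmx (A *m B) = adjmx B *m adjmx A.
Proof. by rewrite /adjmx map_mxM trmx_mul. Qed.

Lemma adjmxK n p (A : 'M[C]_(n, p)) : adjmx (adjmx A) = A.
Proof. by apply/matrixP => i j; rewrite !mxE conjCK. Qed.

Lemma adjmx1 n : adjmx (1%:M : 'M[C]_n) = 1%:M.
Proof. by rewrite /adjmx map_mx1 trmx1. Qed.

(** The realification of multiplication by [i]. Commutation with it is a closed condition, so it
    passes from the flows to [K] and to tangent vectors, which are thereby complex matrices. *)
Definition mulJ n : 'M[R]_(n + n) := block_mx 0 (- 1%:M) 1%:M 0.

Lemma realify_mulJ n (A : 'M[C]_n) : realify A *m mulJ n = mulJ n *m realify A.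
Proof.
rewrite /realify /mulJ !mulmx_block.
by congr block_mx; rewrite !(mulmx0, mul0mx, mulmx1, mul1mx, mulmxN, mulNmx,
  add0r, addr0, opprK).
Qed.

Lemma mulJ_realify n (X : 'M[R]_(n + n)) : X *m mulJ n = mulJ n *m X ->
  exists A : 'M[C]_n, X = realify A.
Proof.
move=> hX; exists (\matrix_(i, j) Complex (ulsubmx X i j) (dlsubmx X i j)).
move: hX; rewrite -[X in X *m _]submxK -[X in _ = _ *m X]submxK /mulJ !mulmx_block.
rewrite !(mulmx0, mul0mx, mulmx1, mul1mx, mulmxN, mulNmx, add0r, addr0, opprK).
move=> /eq_block_mx[hur hul hdr hdl].
rewrite -[LHS]submxK /realify; congr block_mx.
- by apply/matrixP => i j; rewrite !mxE.
- by rewrite hur; congr (- _); apply/matrixP => i j; rewrite !mxE.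
- by apply/matrixP => i j; rewrite !mxE.
- by rewrite hdr; apply/matrixP => i j; rewrite !mxE.
Qed.
End Realification.

(** * Unitary flows of Hermitian matrices *)

Section HermitianFlow.
Variables (R : realType) (n : nat).
Local Notation C := R[i].
Local Notation Re := (@complex.Re R).
Local Notation Im := (@complex.Im R).

Definition expNi (a : R) : C := Complex (cos a) (- sin a).

Lemma expNi0 : expNi 0 = 1.
Proof. by apply: complex_eq; rewrite /= ?cos0 ?sin0 ?oppr0. Qed.

Lemma expNiD a b : expNi (a + b) = expNi a * expNi b.
Proof. by apply: complex_eq; rewrite (cReM, cImM) /= (cosD, sinD); ring. Qed.

Lemma expNi_unit a : expNi a * Num.conj (expNi a) = 1.
Proof.
apply: complex_eq; rewrite (cReM, cImM) cRe_conj cIm_conj /= -?(cos2Dsin2 a); ring.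
Qed.

(* [exp (- i t H)] for Hermitian [H], through the spectral theorem. *)
Definition hflow (H : 'M[C]_n) (t : R) : 'M[C]_n :=
  adjmx (spectralmx H) *m
  diag_mx (\row_k expNi (Re (spectral_diag H 0 k) * t)) *m spectralmx H.

Lemma spectralmx_adj (H : 'M[C]_n) : spectralmx H *m adjmx (spectralmx H) = 1%:M.
Proof. by have /unitarymxP <- := spectral_unitarymx H; rewrite /adjmx map_trmx. Qed.

Lemma hermitian_spectral (H : 'M[C]_n) : is_hermitian H ->
  H = adjmx (spectralmx H) *m diag_mx (spectral_diag H) *m spectralmx H /\
  forall k, spectral_diag H 0 k = Complex (Re (spectral_diag H 0 k)) 0.
Proof.
move=> hH; have hh : H \is hermsymmx.
  by rewrite is_hermitianmxE expr0 scale1r -{1}hH /adjmx map_trmx.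
split; last first.
  move=> k; have /mxOverP/(_ 0 k) := hermitian_spectral_diag_real hh.
  by move=> /RRe_real {1}<-.
have eP : invmx (spectralmx H) = adjmx (spectralmx H).
  by rewrite (invmx_unitary (spectral_unitarymx H)) /adjmx map_trmx.
by rewrite -eP; exact/orthomx_spectralP/hermitian_normalmx.
Qed.

Variable H : 'M[C]_n.
Hypothesis hH : is_hermitian H.

Let P := spectralmx H.
Let l k : R := Re (spectral_diag H 0 k).

Let Punit : P *m adjmx P = 1%:M. Proof. exact: spectralmx_adj. Qed.

Let Punit' : adjmx P *m P = 1%:M. Proof. exact: mulmx1C. Qed.

Let H_spectral : H = adjmx P *m diag_mx (\row_k Complex (l k) 0) *m P.
Proof.
have [eH hl] := hermitian_spectral hH; rewrite [LHS]eH -/P.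
by congr (_ *m diag_mx _ *m _); apply/rowP => k; rewrite mxE hl.
Qed.

Lemma hflow0 : hflow H 0 = 1%:M.
Proof.
rewrite /hflow (_ : \row_k _ = const_mx 1).
  by rewrite diag_const_mx mulmx1 -/P Punit'.
by apply/rowP => k; rewrite !mxE mulr0 expNi0.
Qed.

Lemma hflowD s t : hflow H (s + t) = hflow H s *m hflow H t.
Proof.
rewrite /hflow -/P !mulmxA -(mulmxA _ P) Punit mulmx1 -[in RHS](mulmxA (adjmx P)).
rewrite mulmx_diag; congr (_ *m diag_mx _ *m _).
by apply/rowP => k; rewrite !mxE mulrDr expNiD.
Qed.

Lemma hflow_unitary t : adjmx (hflow H t) *m hflow H t = 1%:M.
Proof.
rewrite /hflow -/P !adjmxM adjmxK !mulmxA -(mulmxA _ P (adjmx P)) Punit mulmx1.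
rewrite /adjmx map_diag_mx tr_diag_mx -(mulmxA _^T) mulmx_diag.
rewrite (_ : \row_j _ = const_mx 1); last first.
  by apply/rowP => k; rewrite !mxE mulrC expNi_unit.
by rewrite diag_const_mx mulmx1 -/(adjmx P) Punit'.
Qed.

(** The determinant is the product of the [expNi] of the eigenvalues times [t], that is [expNi] of
    [t] times the trace. *)
Lemma det_hflow t : \tr H = 0 -> \det (hflow H t) = 1.
Proof.
rewrite {1}H_spectral mxtrace_mulC mulmxA Punit mul1mx mxtrace_diag => htr.
rewrite /hflow det_mulmx mulrC det_mulmx mulrA -det_mulmx -/P Punit det1 mul1r.
rewrite det_diag.
under eq_bigr do rewrite mxE.
rewrite -(big_morph expNi expNiD expNi0) -mulr_suml.
suff -> : \sum_i Re (spectral_diag H 0 i) = 0 by rewrite mul0r expNi0.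
move/(congr1 Re): htr; rewrite cRe_sum => htr; rewrite -[RHS]/(Re 0) -htr.
by apply: eq_bigr => k _; rewrite mxE.
Qed.

(** In an eigenbasis every entry is a trigonometric sum with the eigenvalues as frequencies, so
    derivatives reduce to those of [cos] and [sin]. *)
Lemma hflow_entry t i j :
  hflow H t i j = \sum_k Num.conj (P k i) * P k j * expNi (l k * t).
Proof.
rewrite /hflow mxE; apply: eq_bigr => k _.
by rewrite mul_mx_diag !mxE -/P mulrAC.
Qed.

Lemma Hhflow_entry t i j : (H *m hflow H t) i j =
  \sum_k Num.conj (P k i) * P k j * (Complex (l k) 0 * expNi (l k * t)).
Proof.
rewrite {1}H_spectral /hflow -/P !mulmxA -(mulmxA _ P) Punit mulmx1.
rewrite -(mulmxA (adjmx P)) mulmx_diag mxE; apply: eq_bigr => k _.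
by rewrite mul_mx_diag !mxE mulrAC.
Qed.

Lemma is_derive_sum_trig (a b w : 'I_n -> R) (t : R) :
  is_derive t 1 (fun t => \sum_k (a k * cos (w k * t) + b k * sin (w k * t)))
    (\sum_k (a k * (- sin (w k * t) * w k) + b k * (cos (w k * t) * w k))).
Proof.
have hk k : is_derive t 1 (fun t => a k * cos (w k * t) + b k * sin (w k * t))
    (a k * (- sin (w k * t) * w k) + b k * (cos (w k * t) * w k)).
  have hw : is_derive t 1 (fun t : R => w k * t) (w k).
    have := is_deriveZ (w k) (is_derive_id t 1).
    by move=> h; apply: is_derive_eq h _; rewrite [_ *: _]mulr1.
  have hc := is_derive1_comp (is_derive_cos (w k * t)) hw.
  have hs := is_derive1_comp (is_derive_sin (w k * t)) hw.
  exact: is_deriveD (is_deriveZ (a k) hc) (is_deriveZ (b k) hs).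
have := is_derive_sum hk; congr (is_derive _ _ _ _).
by apply/funext => s; rewrite fct_sumE.
Qed.

Lemma is_derive_Re_hflow (t : R) i j : is_derive t 1 (fun t : R => Re (hflow H t i j))
  (Re (- 'i * (H *m hflow H t) i j)).
Proof.
pose c k := Num.conj (P k i) * P k j.
have := is_derive_sum_trig (fun k => Re (c k)) (fun k => Im (c k)) l t.
congr (is_derive _ _ _ _).
  apply/funext => s; rewrite hflow_entry cRe_sum; apply: eq_bigr => k _.
  by rewrite [in RHS]cReM /= mulrN opprK.
rewrite Hhflow_entry mulr_sumr cRe_sum; apply: eq_bigr => k _.
by rewrite -/(c k) !(cReM, cImM, cReN, cImN) /=; ring.
Qed.

Lemma is_derive_Im_hflow (t : R) i j : is_derive t 1 (fun t : R => Im (hflow H t i j))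
  (Im (- 'i * (H *m hflow H t) i j)).
Proof.
pose c k := Num.conj (P k i) * P k j.
have := is_derive_sum_trig (fun k => Im (c k)) (fun k => - Re (c k)) l t.
congr (is_derive _ _ _ _).
  apply/funext => s; rewrite hflow_entry cIm_sum; apply: eq_bigr => k _.
  by rewrite [in RHS]cImM /=; ring.
rewrite Hhflow_entry mulr_sumr cIm_sum; apply: eq_bigr => k _.
by rewrite -/(c k) !(cReM, cImM, cReN, cImN) /=; ring.
Qed.

End HermitianFlow.

Lemma realify_hflow_diff (R : realType) (n : nat) (H : 'M[R[i]]_n) :
  is_hermitian H -> forall e : R, 0 < e -> exists2 dl : R, 0 < dl &
  forall t, `|t| <= dl -> `|realify (hflow H t) - 1%:M -
    t *: realify (- 'i *: H)| <= e * `|t|.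
Proof.
move=> hH e e0.
have hRe (ij : 'I_n * 'I_n) : exists dl : R, 0 < dl /\ forall t, `|t| <= dl ->
    `|complex.Re ((hflow H t - 1%:M) ij.1 ij.2) -
     t * complex.Re ((- 'i *: H) ij.1 ij.2)| <= e * `|t|.
  have [dl dl0 hdl] := is_derive_near (is_derive_Re_hflow hH 0 ij.1 ij.2) e0.
  exists dl; split=> // t /hdl; rewrite add0r hflow0 // mulmx1.
  by move: (hflow H t) => g; rewrite !mxE cReD cReN.
have hIm (ij : 'I_n * 'I_n) : exists dl : R, 0 < dl /\ forall t, `|t| <= dl ->
    `|complex.Im ((hflow H t - 1%:M) ij.1 ij.2) -
     t * complex.Im ((- 'i *: H) ij.1 ij.2)| <= e * `|t|.
  have [dl dl0 hdl] := is_derive_near (is_derive_Im_hflow hH 0 ij.1 ij.2) e0.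
  exists dl; split=> // t /hdl; rewrite add0r hflow0 // mulmx1.
  by move: (hflow H t) => g; rewrite !mxE cImD cImN.
have [gr hgr] := choice hRe; have [gi hgi] := choice hIm.
exists (\big[Order.min/1]_ij Order.min (gr ij) (gi ij)).
  by apply: lt_bigmin => // ij _; rewrite lt_min (hgr ij).1 (hgi ij).1.
move=> t ht; rewrite -(realify1 R n) -realifyB.
have htr ij : `|t| <= gr ij /\ `|t| <= gi ij.
  by apply/andP; rewrite -le_min; apply: le_trans ht _; exact: bigmin_le.
have {}hRe i j := (hgr (i, j)).2 t (htr (i, j)).1.
have {}hIm i j := (hgi (i, j)).2 t (htr (i, j)).2.
move: (hflow H t - 1%:M) (- 'i *: H) hRe hIm => M N /= hRe hIm.
apply: mx_norm_le => [|i j]; first by rewrite mulr_ge0 // ltW.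
rewrite /realify scale_block_mx opp_block_mx add_block_mx.
case: (split_ordP i) => i' ->; case: (split_ordP j) => j' ->;
  rewrite ?(block_mxEul, block_mxEur, block_mxEdl, block_mxEdr) !mxE //.
by rewrite mulrN -opprD normrN.
Qed.

Section FlowDerivative.
Variables (R : realType) (n p : nat).
Local Notation C := R[i].
Local Notation Re := (@complex.Re R).
Local Notation Im := (@complex.Im R).
Variable H : 'M[C]_n.
Hypothesis hH : is_hermitian H.

(** In an eigenbasis, a matrix commuting with [H] has nonzero entries only between equal
    eigenvalues, hence it commutes with every function of the diagonal part. *)
Lemma hflow_commute (X : 'M[C]_n) t : X *m H = H *m X ->
  X *m hflow H t = hflow H t *m X.
Proof.
have [eH _] := hermitian_spectral hH; have PP := spectralmx_adj H.
rewrite /hflow; move: (spectralmx H) (spectral_diag H) PP eH => P l PP eH.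
have PP' : adjmx P *m P = 1%:M by exact: mulmx1C.
set E := diag_mx (\row_k _); pose Y := P *m X *m adjmx P => hX.
have YD : Y *m diag_mx l = diag_mx l *m Y.
  have := congr1 (fun Z => P *m Z *m adjmx P) hX; rewrite eH /Y !mulmxA PP mul1mx.
  by rewrite -!(mulmxA _ P (adjmx P)) PP !mulmx1.
have eX : X = adjmx P *m Y *m P.
  by rewrite /Y !mulmxA PP' mul1mx -mulmxA PP' mulmx1.
clearbody Y.
have YE : Y *m E = E *m Y.
  apply/matrixP => i j; have /matrixP/(_ i j) := YD.
  rewrite /E !(mul_mx_diag, mul_diag_mx) !mxE [l 0 i * _]mulrC => h.
  rewrite [RHS]mulrC; have [->|Yn0] := eqVneq (Y i j) 0; first by rewrite !mul0r.
  by have -> := mulfI Yn0 h.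
rewrite eX !mulmxA -!(mulmxA _ P (adjmx P)) PP !mulmx1.
by rewrite -!(mulmxA (adjmx P)) YE.
Qed.

Lemma hflow_comm t : H *m hflow H t = hflow H t *m H.
Proof. exact: hflow_commute. Qed.

Lemma is_derive_Re_hflowM (q : 'M[C]_(n, p)) (t : R) i j :
  is_derive t 1 (fun t : R => Re ((hflow H t *m q) i j))
    (Re ((hflow H t *m (- 'i *: (H *m q))) i j)).
Proof.
pose h k (t : R) : R := Re (hflow H t i k) * Re (q k j) - Im (hflow H t i k) * Im (q k j).
pose dh k : R := Re (- 'i * (H *m hflow H t) i k) * Re (q k j) -
  Im (- 'i * (H *m hflow H t) i k) * Im (q k j).
have hk k : is_derive t 1 (h k) (dh k).
  have h1 := is_deriveZ (Re (q k j)) (is_derive_Re_hflow hH t i k).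
  have h2 := is_deriveZ (Im (q k j)) (is_derive_Im_hflow hH t i k).
  have := is_deriveB h1 h2; congr (is_derive _ _ _ _).
    by apply/funext => s; rewrite /h (mulrC (Re (hflow _ _ _ _))) (mulrC (Im _)).
  by rewrite /dh (mulrC (Re (_ * _))) (mulrC (Im (_ * _))).
have := is_derive_sum hk; congr (is_derive _ _ _ _).
  by apply/funext => s; rewrite fct_sumE mxE cRe_sum; apply: eq_bigr => k _; rewrite cReM.
rewrite -scalemxAr mulmxA -hflow_comm [in RHS]mxE [in RHS]mxE mulr_sumr cRe_sum.
by apply: eq_bigr => k _; rewrite mulrA cReM.
Qed.

Lemma is_derive_Im_hflowM (q : 'M[C]_(n, p)) (t : R) i j :
  is_derive t 1 (fun t : R => Im ((hflow H t *m q) i j))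
    (Im ((hflow H t *m (- 'i *: (H *m q))) i j)).
Proof.
pose h k (t : R) : R := Re (hflow H t i k) * Im (q k j) + Im (hflow H t i k) * Re (q k j).
pose dh k : R := Re (- 'i * (H *m hflow H t) i k) * Im (q k j) +
  Im (- 'i * (H *m hflow H t) i k) * Re (q k j).
have hk k : is_derive t 1 (h k) (dh k).
  have h1 := is_deriveZ (Im (q k j)) (is_derive_Re_hflow hH t i k).
  have h2 := is_deriveZ (Re (q k j)) (is_derive_Im_hflow hH t i k).
  have := is_deriveD h1 h2; congr (is_derive _ _ _ _).
    by apply/funext => s; congr (_ + _); exact: mulrC.
  by congr (_ + _); exact: mulrC.
have := is_derive_sum hk; congr (is_derive _ _ _ _).
  by apply/funext => s; rewrite fct_sumE mxE cIm_sum; apply: eq_bigr => k _; rewrite cImM.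
rewrite -scalemxAr mulmxA -hflow_comm [in RHS]mxE [in RHS]mxE mulr_sumr cIm_sum.
by apply: eq_bigr => k _; rewrite mulrA cImM.
Qed.
End FlowDerivative.

Lemma integrable_disjU (d : measure_display) (T : measurableType d) (R : realType)
  (mu : {measure set T -> \bar R}) (A B : set T) (f : T -> \bar R) :
  measurable A -> measurable B -> [disjoint A & B] ->
  mu.-integrable A f -> mu.-integrable B f -> mu.-integrable (A `|` B) f.
Proof.
move=> mA mB AB /integrableP[mfA iA] /integrableP[mfB iB].
have mf := (measurable_funU _ mA mB).2 (conj mfA mfB).
apply/integrableP; split => //; rewrite ge0_integral_setU //.
  exact: lte_add_pinfty.
by apply: measurableT_comp.
Qed.

(** * Integrals along concatenated trajectories *)

Section IntegralConcat.
Variable R : realType.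
Local Notation mu := (@lebesgue_measure R).

Lemma is_derive_continuous (f : R -> R) (df : R -> R) :
  (forall x : R, is_derive x 1 f (df x)) -> continuous f.
Proof.
move=> h x; apply: differentiable_continuous; apply/derivable1_diffP.
by have [] := h x.
Qed.

Lemma is_derive_FTC (G g : R -> R) (a b : R) : a < b ->
  (forall s : R, is_derive s 1 G (g s)) -> continuous g ->
  mu.-integrable `[a, b] (EFin \o g) /\ \int[mu]_(s in `[a, b]) g s = G b - G a.
Proof.
move=> ab hG cg; have cG := is_derive_continuous hG.
have wg : {within `[a, b], continuous g} by exact: continuous_subspaceT.
split.
  by apply: continuous_compact_integrable => //; exact: segment_compact.
rewrite /Rintegral (@continuous_FTC2 _ g G) //.
  split; first by move=> s _; have [] := hG s.
    exact/cvg_at_right_filter/cG.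
  exact/cvg_at_left_filter/cG.
by move=> s _; rewrite derive1E; have [] := hG s.
Qed.

Lemma integral_concat (f g G : R -> R) (T t : R) : 0 <= T -> T < t ->
  mu.-integrable `[0, T] (EFin \o f) ->
  (forall s : R, is_derive s 1 G (g s)) -> continuous g ->
  let h s := if s <= T then f s else g s in
  mu.-integrable `[0, t] (EFin \o h) /\
  \int[mu]_(s in `[0, t]) h s = \int[mu]_(s in `[0, T]) f s + (G t - G T).
Proof.
move=> T0 Tt If hG cg h; have [Ig eG] := is_derive_FTC Tt hG cg.
have hf : {in `[0, T]%classic, h =1 f}.
  by move=> s; rewrite inE /= in_itv /= => /andP[_ sT]; rewrite /h sT.
have hg : {in `]T, t]%classic, h =1 g}.
  by move=> s; rewrite inE /= in_itv /= => /andP[sT _]; rewrite /h leNgt sT.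
have Ih1 : mu.-integrable `[0, T] (EFin \o h).
  by apply: eq_integrable If => // s /hf /= ->.
have Ig2 : mu.-integrable `]T, t] (EFin \o g).
  apply: integrableS Ig => // s /=; rewrite !in_itv /= => /andP[Ts ->].
  by rewrite ltW.
have Ih2 : mu.-integrable `]T, t] (EFin \o h).
  by apply: eq_integrable Ig2 => // s /hg /= ->.
have eU : `[0, t]%classic = `[0, T]%classic `|` `]T, t]%classic.
  by rewrite -itv_bndbnd_setU // bnd_simp // ltW.
have dis : [disjoint `[0, T]%classic & `]T, t]%classic].
  apply/disj_setPS => y [] /=; rewrite !in_itv /=.
  by move=> /andP[_ ys] /andP[]; rewrite ltNge ys.
have IU : mu.-integrable `[0, t] (EFin \o h).
  by rewrite eU; apply: integrable_disjU.
split=> //; rewrite eU Rintegral_setU -?eU //.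
congr (_ + _); first exact: eq_Rintegral.
by rewrite -eG -Rintegral_itv_obnd_cbnd //; exact: eq_Rintegral.
Qed.
End IntegralConcat.

(** * Reachable sets *)

Section Reachability.
Variables (R : realType) (n m : nat).
Local Notation C := R[i].
Local Notation Re := (@complex.Re R).
Local Notation Im := (@complex.Im R).
Local Notation mu := (@lebesgue_measure R).
Variables (U : set 'rV[R]_m) (H : 'rV[R]_m -> 'M[C]_n).
Hypothesis hH : forall u, U u -> is_hermitian (H u).

Inductive flow_semigrp : 'M[C]_n -> Prop :=
| flow_semigrp1 : flow_semigrp 1%:M
| flow_semigrpE u t g : U u -> 0 <= t -> flow_semigrp g ->
    flow_semigrp (hflow (H u) t *m g).

(** Even a trajectory of duration zero carries a control with a value in [U] at time [0], hence the
    point [u]. *)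
Lemma reachable_refl (p : nat) (M : set 'M[C]_(n, p)) u q :
  U u -> M q -> reachable M U H q q.
Proof.
move=> Uu Mq; exists 0, (fun=> u), (fun=> q); split=> //; split.
  split; first by move=> t _.
  split; first by move=> j; exact: measurable_cst.
  exists (\big[Order.max/0]_j `|u ord0 j|) => j.
  by apply: aeW => t _; exact: le_bigmax.
split; last by split=> // t _.
split=> // t /=; rewrite in_itv /= => /andP[t0 tle] i j.
have -> : t = 0 by apply/le_anti; rewrite tle t0.
have null (f : R -> R) : mu.-integrable `[0, 0] (EFin \o f).
  rewrite set_itv1; apply/integrableP; split.
    by apply/measurable_EFinP; exact: measurable_fun_set1.
  by rewrite integral_set1.
by rewrite set_itv1 !Rintegral_set1 !addr0 -!set_itv1; split; [exact: null|split; first exact: null].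
Qed.

(** The given control is continued by the constant [w]. After time [T] the state is a primitive of
    its velocity, so the added integral is the increment from the value [q] at [T]. *)
Lemma reachable_flow (p : nat) (M : set 'M[C]_(n, p)) q0 q w (t : R) :
  U w -> 0 <= t -> (forall s x, M x -> M (hflow (H w) s *m x)) ->
  reachable M U H q0 q -> reachable M U H q0 (hflow (H w) t *m q).
Proof.
move=> Uw; rewrite le_eqVlt => /predU1P[<- _|]; first by rewrite hflow0 mul1mx.
move=> t0 hM [T [u [X [T0 [[Uu [mu_u [B hB]]] [[X0 hX] [MX XT]]]]]]].
pose u' s := if s <= T then u s else w.
pose X' s := if s <= T then X s else hflow (H w) (s - T) *m q.
have tT : T < T + t by rewrite ltrDl.
exists (T + t), u', X'; split; first by rewrite addr_ge0 // ltW.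
split; first split; last split; last split.
- move=> s /=; rewrite in_itv /= /u' => /andP[s0 _].
  by case: ifP => // sT; apply: Uu; rewrite /= in_itv /= s0.
- split=> [j|].
    rewrite (_ : (fun s => u' s ord0 j) =
        (fun s => if s <= T then u s ord0 j else w ord0 j)); last first.
      by apply/funext => s; rewrite /u'; case: ifP.
    apply: measurable_fun_if => //.
    + exact: measurable_fun_ler.
    + apply: measurable_funS (mu_u j) => //.
      by move=> s [] /=; rewrite !in_itv /= => /andP[-> _] ->.
  exists (Order.max B (\big[Order.max/0]_j `|w ord0 j|)) => j.
  have FF : Filter (almost_everywhere mu) := ae_filter_ringOfSetsType mu.
  apply: filterS (hB j) => s hs; rewrite /= in_itv /= /u' => /andP[s0 _].
  rewrite le_max; case: ifP => sT; first by rewrite hs //= in_itv /= s0.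
  by apply/orP; right; exact: le_bigmax.
- split; first by rewrite /X' T0.
  move=> s /=; rewrite in_itv /= => /andP[s0 sTt] i j.
  have [sT|Ts] := leP s T.
    have [|h1 [h2 [h3 h4]]] := hX s _ i j; first by rewrite /= in_itv /= s0.
    have e (y : R) : y \in `[0, s]%classic ->
        - 'i * (H (u' y) *m X' y) i j = - 'i * (H (u y) *m X y) i j.
      rewrite inE /= in_itv /= => /andP[_ ys].
      by rewrite /u' /X' (le_trans ys sT).
    have -> : X' s = X s by rewrite /X' sT.
    split; first by apply: eq_integrable h1 => // y /e /= ->.
    split; first by apply: eq_integrable h2 => // y /e /= ->.
    by split; [rewrite h3|rewrite h4]; congr (_ + _); apply: eq_Rintegral => y /e ->.
  have [|h1 [h2 [h3 h4]]] := hX T _ i j; first by rewrite /= in_itv /= T0 lexx.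
  pose qd := - 'i *: (H w *m q).
  have sh (G g : R -> R) : (forall y : R, is_derive y 1 G (g y)) ->
      forall y : R, is_derive y 1 (fun y => G (y - T)) (g (y - T)).
    move=> hG y; have hy : is_derive y 1 (fun y : R => y - T) 1.
      have := is_deriveB (is_derive_id y 1) (is_derive_cst T y 1).
      by congr (is_derive _ _ _ _); rewrite subr0.
    by have := @is_derive1_comp R G (fun y => y - T) y _ _ (hG (y - T)) hy; rewrite mulr1.
  have ef (y : R) : - 'i * (H w *m (hflow (H w) (y - T) *m q)) i j =
      (hflow (H w) (y - T) *m qd) i j.
    by rewrite /qd -scalemxAr [RHS]mxE (mulmxA (H w)) (hflow_comm (hH Uw)) -mulmxA.
  have hRe := sh _ _ (fun y => is_derive_Re_hflowM (hH Uw) q y i j).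
  have hIm := sh _ _ (fun y => is_derive_Im_hflowM (hH Uw) q y i j).
  have cRe : continuous (fun y : R => Re ((hflow (H w) (y - T) *m qd) i j)).
    exact: is_derive_continuous (sh _ _ (fun y => is_derive_Re_hflowM (hH Uw) qd y i j)).
  have cIm : continuous (fun y : R => Im ((hflow (H w) (y - T) *m qd) i j)).
    exact: is_derive_continuous (sh _ _ (fun y => is_derive_Im_hflowM (hH Uw) qd y i j)).
  have [iRe eRe] := integral_concat T0 Ts h1 hRe cRe.
  have [iIm eIm] := integral_concat T0 Ts h2 hIm cIm.
  have hreq (F : C -> R) : (fun y => F (- 'i * (H (u' y) *m X' y) i j)) =
      (fun y => if y <= T then F (- 'i * (H (u y) *m X y) i j)
                else F ((hflow (H w) (y - T) *m qd) i j)).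
    by apply/funext => y; rewrite /u' /X'; case: ifP => // _; rewrite ef.
  have eX' : X' s = hflow (H w) (s - T) *m q by rewrite /X' leNgt Ts.
  rewrite eX'; split.
    by apply: eq_integrable iRe => // y _ /=; rewrite -(congr1 (@^~ y) (hreq Re)).
  split.
    by apply: eq_integrable iIm => // y _ /=; rewrite -(congr1 (@^~ y) (hreq Im)).
  rewrite (hreq Re) (hreq Im) eRe eIm !addrA -h3 -h4 subrr hflow0 mul1mx XT.
  by split; rewrite [RHS]addrAC subrr add0r.
- move=> s /=; rewrite in_itv /= /X' => /andP[s0 _].
  case: ifP => sT; first by apply: MX; rewrite /= in_itv /= s0.
  by apply: hM; rewrite -XT; apply: MX; rewrite /= in_itv /= T0 lexx.
- by rewrite /X' leNgt tT /= addrC addKr.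
Qed.

Lemma reachable_semigrp (p : nat) (M : set 'M[C]_(n, p)) q g : U !=set0 ->
  (forall w s x, U w -> M x -> M (hflow (H w) s *m x)) -> M q ->
  flow_semigrp g -> reachable M U H q (g *m q).
Proof.
move=> [u Uu] hM Mq; elim=> [|w t g' Uw t0 _ IH].
  by rewrite mul1mx; exact: (reachable_refl Uu).
by rewrite -mulmxA; apply: reachable_flow => // s x; exact: hM.
Qed.

(** The index type carries membership in [U], which is what makes [H] Hermitian. *)
Definition realflow (k : {u | U u}) (t : R) := realify (hflow (H (sval k)) t).
Definition realgen (k : {u | U u}) := realify (- 'i *: H (sval k)).

Lemma realflowD k s t : realflow k (s + t) = realflow k s *m realflow k t.
Proof. by rewrite /realflow hflowD realifyM. Qed.

Lemma realflow_orth k t : (realflow k t)^T *m realflow k t = 1%:M.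
Proof.
by rewrite /realflow -realify_adj -realifyM hflow_unitary realify1.
Qed.

Lemma realflow_diff k (e : R) : 0 < e -> exists2 dl : R, 0 < dl &
  forall t, `|t| <= dl -> `|realflow k t - 1%:M - t *: realgen k| <= e * `|t|.
Proof. by move=> e0; apply: realify_hflow_diff => //; exact: hH (svalP k). Qed.

Lemma semigrp_realflow r : semigrp realflow r ->
  exists2 g, flow_semigrp g & r = realify g.
Proof.
elim=> [|k t r' t0 _ [g Sg ->]].
  by exists 1%:M; [exact: flow_semigrp1|rewrite realify1].
exists (hflow (H (sval k)) t *m g); last by rewrite realifyM.
by apply: flow_semigrpE => //; exact: (svalP k).
Qed.

Lemma flow_semigrp_realflow g : flow_semigrp g -> semigrp realflow (realify g).
Proof.
elim=> [|u t g' Uu t0 _ Sg']; first by rewrite realify1; exact: semigrp1.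
rewrite realifyM -[realify (hflow _ _)]/(realflow (exist _ u Uu) t).
exact: semigrpE.
Qed.

Lemma reachable_approx (p : nat) (M : set 'M[C]_(n, p)) q0 q :
  reachable M U H q0 q -> forall e : R, 0 < e ->
  exists2 s, semigrp realflow s & `|realcol q - s *m realcol q0| <= e.
Proof.
move=> [T [u [X [T0 [[Uu _] [[X0 hX] [_ XT]]]]]]] e e0.
pose f t := realcol (- 'i *: (H (u t) *m X t)).
have hin (t : R) : 0 <= t <= T -> `[0, T]%classic t by rewrite /= in_itv.
have TT : 0 <= T <= T by rewrite T0 lexx.
have := @semigrp_integral_curve R (n + n) p _ realflow realgen realflow_orth
  realflow_diff (fun t => realcol (X t)) f T T0 _ _ _ e e0.
rewrite XT X0; apply.
- move=> i j; have := hX T (hin _ TT); rewrite /f /realcol.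
  case: (split_ordP i) => k -> /(_ k j) [h1 [h2 _]].
    by apply: eq_integrable h1 => // t _ /=; rewrite col_mxEu !mxE.
  by apply: eq_integrable h2 => // t _ /=; rewrite col_mxEd !mxE.
- move=> t /hin tT i j; have := hX t tT; rewrite /f /realcol.
  case: (split_ordP i) => k -> /(_ k j) [_ [_ [h1 h2]]].
    rewrite !col_mxEu !mxE h1; congr (_ + _); apply: eq_Rintegral => s _.
    by rewrite col_mxEu !mxE.
  rewrite !col_mxEd !mxE h2; congr (_ + _); apply: eq_Rintegral => s _.
  by rewrite col_mxEd !mxE.
- move=> t /hin tT; exists (exist _ (u t) (Uu t tT)).
  by rewrite /f /realgen /= -realcolM scalemxAl.
Qed.
End Reachability.

(** * Determinants near the identity and scalar tangent directions *)

Section DetTangent.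
Variable R : realType.
Local Notation C := R[i].
Local Notation normc := (@Normc.normc R).

Lemma normc_le (x : C) : normc x <= `|complex.Re x| + `|complex.Im x|.
Proof.
case: x => a b /=; rewrite -(@ler_pXn2r _ 2) ?nnegrE ?sqrtr_ge0 ?addr_ge0 //.
rewrite sqr_sqrtr ?addr_ge0 ?sqr_ge0 // sqrrD !real_normK ?num_real //.
by rewrite addrAC lerDl mulrn_wge0 // mulr_ge0.
Qed.

Lemma normc_ge0 (x : C) : 0 <= normc x.
Proof. by case: x => a b; exact: sqrtr_ge0. Qed.

(** Factors are exchanged one at a time; [1 <= M] lets the powers arising for different lengths be
    merged. *)
Lemma normc_prodB (I : Type) (s : seq I) (a b : I -> C) (M d : R) :
  1 <= M -> 0 <= d ->
  (forall i, [/\ normc (a i) <= M, normc (b i) <= M & normc (a i - b i) <= d]) ->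
  normc (\prod_(i <- s) b i) <= M ^+ size s /\
  normc (\prod_(i <- s) a i - \prod_(i <- s) b i) <= (size s)%:R * M ^+ size s * d.
Proof.
move=> M1 d0 h; have M0 : 0 <= M by exact: le_trans M1.
elim: s => [|i s [IH1 IH2]] /=.
  by rewrite !big_nil subrr Normc.normc0 mulr0n !mul0r Normc.normc1.
have [ha hb hd] := h i; rewrite !big_cons; split.
  by rewrite Normc.normcM exprS; apply: ler_pM => //; exact: normc_ge0.
set u := \prod_(j <- s) a j in IH2 *; set v := \prod_(j <- s) b j in IH1 IH2 *.
have -> : a i * u - b i * v = a i * (u - v) + (a i - b i) * v by ring.
rewrite (le_trans (le_normcD _ _)) // !Normc.normcM.
apply: (@le_trans _ _ (M * ((size s)%:R * M ^+ size s * d) + d * M ^+ size s)).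
  by apply: lerD; apply: ler_pM => //; exact: normc_ge0.
rewrite exprS -subr_ge0 -natr1.
rewrite (_ : _ - _ = (M - 1) * (M ^+ size s * d)); last by ring.
by rewrite mulr_ge0 ?subr_ge0 // mulr_ge0 // exprn_ge0.
Qed.

Lemma normc_sum (I : Type) (s : seq I) (F : I -> C) (B : R) :
  (forall i, normc (F i) <= B) -> normc (\sum_(i <- s) F i) <= (size s)%:R * B.
Proof.
move=> h; elim: s => [|i s IH]; first by rewrite big_nil Normc.normc0 mul0r.
rewrite big_cons (le_trans (le_normcD _ _)) //= -natr1 mulrDl mul1r addrC.
exact: lerD.
Qed.

Lemma normc_detB (n : nat) (M : R) : 1 <= M -> exists2 D : R, 0 <= D &
  forall (A B : 'M[C]_n) (d : R), 0 <= d ->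
  (forall i j, [/\ normc (A i j) <= M, normc (B i j) <= M & normc (A i j - B i j) <= d]) ->
  normc (\det A - \det B) <= D * d.
Proof.
move=> M1; have M0 : 0 <= M by exact: le_trans M1.
pose N := size (index_enum 'I_n).
exists ((size (index_enum {perm 'I_n}))%:R * (N%:R * M ^+ N)).
  by rewrite !mulr_ge0 // exprn_ge0.
move=> A B d d0 h; rewrite /determinant -sumrB -mulrA; apply: normc_sum => s.
rewrite -mulrBr Normc.normcM.
have -> : normc ((-1) ^+ s) = 1.
  by case: (odd_perm s); rewrite ?expr0 ?expr1 ?normcN Normc.normc1.
rewrite mul1r.
by have [] := @normc_prodB _ (index_enum 'I_n) (fun i => A i (s i)) (fun i => B i (s i))
  M d M1 d0 (fun i => h i (s i)).
Qed.

Lemma normc_binomial (n : nat) (B : R) : 0 <= B -> exists2 D : R, 0 <= D &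
  forall z : C, normc z <= B ->
    normc ((1 + z) ^+ n - 1 - n%:R * z) <= D * normc z ^+ 2.
Proof.
move=> B0; elim: n => [|n [D D0 IH]].
  by exists 0 => // z _; rewrite expr0 subrr mul0r subr0 Normc.normc0 mul0r.
exists ((1 + B) * D + n%:R) => [|z hz]; first by rewrite addr_ge0 ?mulr_ge0 ?addr_ge0.
have -> : (1 + z) ^+ n.+1 - 1 - n.+1%:R * z =
    (1 + z) * ((1 + z) ^+ n - 1 - n%:R * z) + n%:R * (z * z).
  by rewrite exprS -natr1; ring.
rewrite (le_trans (le_normcD _ _)) // [leRHS]mulrDl; apply: lerD.
  rewrite Normc.normcM -mulrA; apply: ler_pM; rewrite ?normc_ge0 ?IH //.
  by rewrite (le_trans (le_normcD _ _)) // Normc.normc1 lerD2l.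
by rewrite mulr_natl normcMn Normc.normcM -expr2 mulr_natl.
Qed.

(* Compare [\det g = 1] with [(1 + i c t)^n = 1 + n i c t + O(t^2)]. *)
Lemma det_tangent_scalar (n : nat) (c : R) : (0 < n)%N ->
  (forall e : R, 0 < e -> exists t, exists g : 'M[C]_n,
    [/\ 0 < t, t <= e, \det g = 1 &
     `|realify g - 1%:M - t *: realify ((Complex 0 c)%:M)| <= e * t]) -> c = 0.
Proof.
(* Entries of [(1 + z) 1] are at most [1 + |c|], and those of [g] differ from them by at most
   [2]. *)
move=> n0 h; pose M : R := 3 + `|c|.
have M1 : 1 <= M by rewrite /M; have := normr_ge0 c; lra.
have [D D0 hD] := normc_detB n M1.
have [D' D'0 hD'] := normc_binomial n (normr_ge0 c).
apply: (@eq0_le_eps _ _ _ (D * 2 + D' * `|c| ^+ 2)) => e e0 e1.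
have [t [g [t0 te dg hg]]] := h e e0.
pose z : C := Complex 0 (c * t).
have nz : normc z = `|c| * t.
  by rewrite /z /= expr0n add0r sqrtr_sqr normrM (gtr0_norm t0).
have t1 : t <= 1 by exact: le_trans e1.
have znc : normc z <= `|c| by rewrite nz ler_piMr.
have et : e * t <= 1 by rewrite mulr_ile1 // ltW.
have hent i j : normc (g i j - (1 + z)%:M i j) <= 2 * (e * t).
  rewrite (le_trans (normc_le _)) // mulr_natl mulr2n; apply: lerD.
    have := le_trans (le_mx_norm _ (lshift n i) (lshift n j)) hg.
    rewrite -(realify1 R n) /realify scale_block_mx !opp_block_mx !add_block_mx.
    rewrite block_mxEul !mxE; apply: le_trans.
    rewrite le_eqVlt; apply/orP; left; apply/eqP; congr (`| _ |).
    by rewrite !(cReD, cReN); case: (i == j); rewrite /= ?(mulr1n, mulr0n) /=; ring.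
  have := le_trans (le_mx_norm _ (rshift n i) (lshift n j)) hg.
  rewrite -(realify1 R n) /realify scale_block_mx !opp_block_mx !add_block_mx.
  rewrite block_mxEdl !mxE; apply: le_trans.
    rewrite le_eqVlt; apply/orP; left; apply/eqP; congr (`| _ |).
  by rewrite !(cImD, cImN); case: (i == j); rewrite /= ?(mulr1n, mulr0n) /=; ring.
have hb (i j : 'I_n) : normc ((1 + z)%:M i j) <= M.
  rewrite mxE; case: (i == j); rewrite ?(mulr1n, mulr0n).
    rewrite (le_trans (le_normcD _ _)) // Normc.normc1 (le_trans (lerD (lexx _) znc)) //.
    by rewrite /M lerD2r; lra.
  by rewrite Normc.normc0 (le_trans ler01).
have hg' i j : normc (g i j) <= M.
  rewrite -[g i j](subrK ((1 + z)%:M i j)) (le_trans (le_normcD _ _)) //.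
  have h1 : normc ((1 + z)%:M i j) <= 1 + `|c|.
    rewrite mxE; case: (i == j); rewrite ?(mulr1n, mulr0n).
      by rewrite (le_trans (le_normcD _ _)) // Normc.normc1 lerD2l.
    by rewrite Normc.normc0 addr_ge0.
  by rewrite /M; have := hent i j; lra.
have hdet : normc ((1 + z) ^+ n - 1) <= D * (2 * (e * t)).
  have et0 : 0 <= 2 * (e * t) by rewrite !mulr_ge0 // ltW.
  have := hD g ((1 + z)%:M) _ et0 (fun i j => And3 (hg' i j) (hb i j) (hent i j)).
  by rewrite dg det_scalar -normcN opprB.
have hbin := hD' z znc.
have : n%:R * (`|c| * t) <= D * (2 * (e * t)) + D' * (`|c| * t) ^+ 2.
  rewrite -nz (_ : n%:R * normc z = normc (n%:R * z)); last first.
    by rewrite mulr_natl [in RHS]mulr_natl normcMn.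
  have -> : n%:R * z = ((1 + z) ^+ n - 1) + - ((1 + z) ^+ n - 1 - n%:R * z) by ring.
  by apply: (le_trans (le_normcD _ _)); rewrite normcN; exact: lerD.
have hn : `|c| * t <= n%:R * (`|c| * t).
  by rewrite ler_peMl ?ler1n // mulr_ge0 // ltW.
move=> /(le_trans hn).
have -> : D * (2 * (e * t)) + D' * (`|c| * t) ^+ 2 =
  (D * 2 * e + D' * `|c| ^+ 2 * t) * t by ring.
rewrite ler_pM2r // => /le_trans; apply; rewrite mulrDl lerD2l ler_wpM2l //.
by rewrite mulr_ge0 // exprn_ge0.
Qed.
End DetTangent.

(** * Closedness of the semigroup of the control system *)

Section ClosedSemigroup.
Variables (R : realType) (n m : nat).
Local Notation C := R[i].
Variables (U : set 'rV[R]_m) (H : 'rV[R]_m -> 'M[C]_n).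
Hypothesis hH : forall u, U u -> is_hermitian (H u).
Hypothesis n0 : (0 < n)%N.

Local Notation realflow := (@realflow R n m U H).
Local Notation realgen := (@realgen R n m U H).

(** The conclusion of Schur's lemma, for skew-Hermitian matrices since tangent vectors are skew. It
    is isolated because the sphere and the group each yield it by their own argument. *)
Definition scalar_commutant : Prop := forall X : 'M[C]_n, adjmx X = - X ->
  (forall u, U u -> X *m H u = H u *m X) -> exists c, X = c%:M.

Lemma comm_mx_closed (p : nat) (X J : 'M[R]_p) :
  (forall e : R, 0 < e -> exists2 Y : 'M[R]_p, `|X - Y| <= e & Y *m J = J *m Y) ->
  X *m J = J *m X.
Proof.
move=> h; apply/eqP; rewrite -subr_eq0; apply/eqP.
apply: (@eq0_le_eps _ _ _ (p%:R * `|J| + p%:R * `|J|)) => e e0 _.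
have [Y XY hY] := h e e0.
have -> : X *m J - J *m X = (X - Y) *m J - J *m (X - Y).
  by rewrite mulmxBl mulmxBr hY; apply/matrixP => i j; rewrite !mxE; ring.
rewrite (le_trans (ler_normB _ _)) // mulrDl; apply: lerD.
  by rewrite mulrAC; exact: mx_normMle.
exact: mx_normMle.
Qed.

Lemma mxtrace_realify (A : 'M[C]_n) : \tr (realify A) = complex.Re (\tr A) *+ 2.
Proof.
rewrite /realify mxtrace_block mulr2n /mxtrace cRe_sum.
by congr (_ + _); apply: eq_bigr => i _; rewrite mxE.
Qed.

Theorem realflow_semigrp_closed : scalar_commutant ->
  forall r, semigrp_cl realflow r -> semigrp realflow r.
Proof.
move=> irr.
have [//|[X [X0 tX nX cX]]] := semigrp_closed_or_normal_tangent
  (@realflowD R n m U H) (@realflow_orth R n m U H) (realflow_diff hH).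
exfalso; move/negP: X0; apply.
have KJ k : semigrp_cl realflow k -> k *m mulJ R n = mulJ R n *m k.
  move=> Kk; apply: comm_mx_closed => e e0; have [s Ss ks] := Kk e e0.
  exists s => //; have [g _ ->] := semigrp_realflow Ss; exact: realify_mulJ.
have XJ : X *m mulJ R n = mulJ R n *m X.
  apply: comm_mx_closed => e e0; have [t [Y [t0 _ YX KY]]] := tX e e0.
  exists Y; first by rewrite distrC.
  have := KJ _ KY; rewrite mulmxDl mulmxDr mul1mx mulmx1 => /addrI.
  by rewrite -scalemxAl -scalemxAr => /(scalerI (lt0r_neq0 t0)).
have [X' eX] := mulJ_realify XJ.
have sX := tangent_skew (@realflow_orth R n m U H) tX.
have [||c eX'] := irr X'.
- by apply: realify_inj; rewrite realify_adj realifyN -eX.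
- move=> u Uu; have := cX (exist _ u Uu); rewrite /realgen /= eX -!realifyM.
  move=> /realify_inj; rewrite -scalemxAl -scalemxAr => /scalerI; apply.
  by rewrite oppr_eq0 neq0Ci.
have hc : Num.conj c = - c.
  have hadj : adjmx X' = - X' by apply: realify_inj; rewrite realify_adj realifyN -eX.
  have /matrixP/(_ (Ordinal n0) (Ordinal n0)) := hadj.
  by rewrite eX' !mxE eqxx mulr1n.
have rc : complex.Re c = 0.
  by have := congr1 (@complex.Re R) hc; rewrite cRe_conj cReN => h; lra.
suff c0 : complex.Im c = 0.
  rewrite eX eX' (_ : c = 0); last exact: complex_eq.
  have -> : (0 : C)%:M = 0 :> 'M[C]_n by apply/matrixP => i j; rewrite !mxE mul0rn.
  by rewrite -(subrr 0) realifyB subrr.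
have [//|c0] := eqVneq (complex.Im c) 0.
(* The inner product of [X = i Im c] with the generator [- i H u] is [- 2 Im c] times the real part
   of the trace of [H u]; the trace is real as [H u] is Hermitian. *)
have trH u : U u -> \tr (H u) = 0.
  move=> Uu; apply: complex_eq; last first.
    rewrite /mxtrace cIm_sum big1 // => i _.
    have /matrixP/(_ i i) := hH Uu; rewrite !mxE => /(congr1 (@complex.Im R)).
    by rewrite cIm_conj => h; lra.
  have := nX (realgen (exist _ u Uu)); rewrite /tdot sX eX mulNmx raddfN /=.
  rewrite /realgen /= -realifyM mxtrace_realify eX' mul_scalar_mx !mxtraceZ.
  set a := complex.Re (\tr (H u)); rewrite mulrA cReM.
  have -> : complex.Re (c * - 'i) = complex.Im c by rewrite cReM /= rc; ring.
  have -> : complex.Im (c * - 'i) = 0 by rewrite cImM /= rc; ring.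
  rewrite mul0r subr0 => hz; have {}hz : complex.Im c * a = 0.
    have h : - (complex.Im c * a *+ 2) = 0.
      apply: hz; exists 1%:M, (exist _ u Uu); first exact: semigrp_cl1.
      by rewrite trmx1 mul1mx mulmx1.
    by move: h; rewrite mulr2n => h; lra.
  by move/eqP: hz; rewrite mulf_eq0 (negbTE c0) => /eqP.
have detS g : flow_semigrp U H g -> \det g = 1.
  elim=> [|u t g' Uu _ _ IH]; first exact: det1.
  by rewrite det_mulmx IH mulr1 (det_hflow (hH Uu)) // trH.
apply: (det_tangent_scalar n0) => e e0.
have e20 : 0 < e / 2 by rewrite divr_gt0.
have [t [Y [t0 te YX KY]]] := tX _ e20.
(* The determinant is known on [S] only, and replacing the point [1 + t Y] of [K] by an element of
   [S] must cost a small multiple of [t] to leave the tangent direction visible. *)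
have te0 : 0 < e / 2 * t by rewrite mulr_gt0.
have [s Ss sY] := KY _ te0; have [g Sg es] := semigrp_realflow Ss.
exists t, g; split=> //; [lra|exact: detS|].
have <- : X = realify (Complex 0 (complex.Im c))%:M.
  by rewrite eX eX'; congr (realify _%:M); exact: complex_eq.
have -> : realify g - 1%:M - t *: X = - (1%:M + t *: Y - s) + t *: (Y - X).
  by rewrite es scalerBr; apply/matrixP => i j; rewrite !mxE; ring.
rewrite (le_trans (ler_normD _ _)) // normrN normrZ gtr0_norm //.
rewrite (le_trans (lerD sY (ler_wpM2l (ltW t0) YX))) //.
by rewrite (mulrC t) -mulrDl -splitr.
Qed.
End ClosedSemigroup.

(** * Transfer to exact controllability, and the sphere *)

Section Controllability.
Variables (R : realType) (n m : nat).
Local Notation C := R[i].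
Variables (U : set 'rV[R]_m) (H : 'rV[R]_m -> 'M[C]_n).
Hypothesis hH : forall u, U u -> is_hermitian (H u).
Local Notation realflow := (@realflow R n m U H).

Lemma normr_realcol_dist2 (p : nat) (A B : 'M[C]_(n, p)) (e : R) : 0 <= e ->
  dist2 A B < e ^+ 2 -> `|realcol A - realcol B| <= e.
Proof.
move=> e0 h; rewrite -realcolB.
have key i j (x : R) : x ^+ 2 <= complex.Re (A i j - B i j) ^+ 2 +
    complex.Im (A i j - B i j) ^+ 2 -> `|x| <= e.
  move=> hx; rewrite -sqrtr_sqr -[e]ger0_norm // -sqrtr_sqr ler_wsqrtr //.
  apply: le_trans hx (le_trans _ (ltW h)); rewrite /dist2 (bigD1 i) //= (bigD1 j) //=.
  by rewrite -addrA lerDl addr_ge0 // !sumr_ge0 // => k _; rewrite ?sumr_ge0 // => *;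
    rewrite addr_ge0 ?sqr_ge0.
apply: mx_norm_le => // i j; rewrite /realcol.
case: (split_ordP i) => k ->; rewrite (col_mxEu, col_mxEd) !mxE; apply: (key k j).
  by rewrite lerDl sqr_ge0.
by rewrite lerDr sqr_ge0.
Qed.

Lemma dist2_refl (p : nat) (A : 'M[C]_(n, p)) : dist2 A A = 0.
Proof.
by rewrite /dist2 big1 // => i _; rewrite big1 // => j _; rewrite subrr /= expr0n addr0.
Qed.

Lemma exact_approx (p : nat) (M : set 'M[C]_(n, p)) :
  exactly_controllable M U H -> approximately_controllable M U H.
Proof.
move=> h q0 Mq0 q Mq e e0; exists q; first by rewrite h.
by rewrite dist2_refl.
Qed.

Lemma approx_semigrp (p : nat) (M : set 'M[C]_(n, p)) :
  approximately_controllable M U H -> forall q0 q, M q0 -> M q ->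
  forall e : R, 0 < e -> exists2 g, flow_semigrp U H g &
    `|realcol q - realcol (g *m q0)| <= e.
Proof.
move=> h q0 q Mq0 Mq e e0; have e20 : 0 < e / 2 by rewrite divr_gt0.
have [q' Rq' hq'] := h q0 Mq0 q Mq _ (exprn_gt0 2 e20).
have [s Ss hs] := reachable_approx hH Rq' e20.
have [g Sg es] := semigrp_realflow Ss; exists g => //.
rewrite realcolM -es (le_trans (ler_distD (realcol q') _ _)) // [leRHS](splitr e).
by apply: lerD => //; apply: normr_realcol_dist2 => //; exact: ltW.
Qed.

Lemma approx_nonempty (p : nat) (M : set 'M[C]_(n, p)) : M !=set0 ->
  approximately_controllable M U H -> U !=set0.
Proof.
move=> [q Mq] h; have [q' [T [u [X [T0 [[Uu _] _]]]]] _] := h q Mq q Mq 1 ltr01.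
by exists (u 0); apply: Uu; rewrite /= in_itv /= lexx.
Qed.

Lemma reachable_exact (p : nat) (M : set 'M[C]_(n, p)) : U !=set0 ->
  (forall w s x, U w -> M x -> M (hflow (H w) s *m x)) ->
  (forall q0 q, M q0 -> M q -> exists2 g, flow_semigrp U H g & g *m q0 = q) ->
  exactly_controllable M U H.
Proof.
move=> U0 hM ht q0 Mq0; apply/seteqP; split=> [q [T [u [X [T0 [_ [_ [MX <-]]]]]]]|q Mq].
  by apply: MX; rewrite /= in_itv /= T0 lexx.
by have [g Sg <-] := ht _ _ Mq0 Mq; apply: reachable_semigrp.
Qed.

Lemma flow_semigrp_commute (X g : 'M[C]_n) :
  (forall u, U u -> X *m H u = H u *m X) -> flow_semigrp U H g -> X *m g = g *m X.
Proof.
move=> hX; elim=> [|u t g' Uu _ _ IH]; first by rewrite mulmx1 mul1mx.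
by rewrite mulmxA (hflow_commute (hH Uu) t (hX _ Uu)) -mulmxA IH mulmxA.
Qed.

Lemma adjmx_col_sphere (psi : 'M[C]_(n, 1)) :
  sphere psi <-> adjmx psi *m psi = 1%:M.
Proof.
have e : (adjmx psi *m psi) 0 0 = \sum_(i < n) `|psi i ord0| ^+ 2.
  by rewrite mxE; apply: eq_bigr => i _; rewrite !mxE mulrC -normCK.
split=> h; last by rewrite /sphere /= -e h mxE.
by apply/matrixP => i j; rewrite !ord1 e h mxE.
Qed.

Lemma sphere_hflow u (t : R) (psi : 'M[C]_(n, 1)) :
  sphere psi -> sphere (hflow (H u) t *m psi).
Proof.
move/adjmx_col_sphere => h; apply/adjmx_col_sphere.
by rewrite adjmxM -mulmxA (mulmxA (adjmx (hflow _ _))) hflow_unitary mul1mx.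
Qed.

Lemma sphere_delta (j : 'I_n) : sphere (delta_mx j 0 : 'M[C]_(n, 1)).
Proof.
rewrite /sphere /= (bigD1 j) //= mxE !eqxx normr1 expr1n big1 ?addr0 // => i ij.
by rewrite mxE (negbTE ij) normr0 expr0n.
Qed.

Lemma realcol_approx_eq0 (p : nat) (Z : 'M[C]_n) (q : 'M[C]_(n, p)) :
  (forall e : R, 0 < e -> exists2 q', Z *m q' = 0 & `|realcol q - realcol q'| <= e) ->
  Z *m q = 0.
Proof.
move=> h; apply: realcol_inj; apply/eqP; rewrite -subr_eq0; apply/eqP.
apply: (@eq0_le_eps _ _ _ ((n + n)%:R * `|realify Z|)) => e e0 _.
have [q' Zq' hq'] := h e e0.
rewrite -Zq' !realcolM -mulmxBr; exact: mx_normMle.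
Qed.

(** An eigenspace of [X] is closed and invariant under the semigroup, which commutes with [X].
    Containing one unit vector, it contains its dense orbit, hence the whole sphere. *)
Lemma sphere_scalar_commutant : (0 < n)%N ->
  approximately_controllable (@sphere R n) U H -> scalar_commutant U H.
Proof.
move=> n0 hap X _ hX.
(* Eigenvectors here are row vectors, so the transpose of [X] provides a column eigenvector of
   [X]. *)
have [a /eigenvalueP[v hv v0]] := eigenvalue_closed X^T n0.
have hw : exists2 w : 'M[C]_(n, 1), sphere w & X *m w = a *: w.
  pose s := \sum_(i < n) `|v 0 i| ^+ 2.
  have s0 : s != 0.
    apply: contra v0 => /eqP hs; apply/eqP/rowP => i; rewrite mxE.
    have /(_ i isT)/eqP := psumr_eq0P (fun i _ => exprn_ge0 2 (normr_ge0 (v 0 i))) hs.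
    by rewrite expf_eq0 normr_eq0 /= => /eqP.
  have sge : 0 <= s by apply: sumr_ge0 => i _; exact: exprn_ge0.
  exists ((sqrtC s)^-1 *: v^T).
    rewrite /sphere /=; under eq_bigr do rewrite !mxE normrM exprMn.
    rewrite -mulr_sumr normfV exprVn ger0_norm ?sqrtC_ge0 // sqrtCK.
    by rewrite mulVf.
  by rewrite -scalemxAr -[X]trmxK -trmx_mul hv linearZ /= !scalerA mulrC.
have [w sw Xw] := hw; exists a; apply/eqP; rewrite -subr_eq0; apply/eqP.
have Zq q : sphere q -> (X - a%:M) *m q = 0.
  move=> sq; apply: realcol_approx_eq0 => e e0.
  have [g Sg hg] := approx_semigrp hap sw sq e0; exists (g *m w) => //.
  rewrite mulmxBl mulmxA (flow_semigrp_commute hX Sg) -mulmxA Xw.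
  by rewrite mul_scalar_mx -scalemxAr subrr.
apply/matrixP => i j; have /matrixP/(_ i 0) := Zq _ (sphere_delta j).
by rewrite -colE mxE => ->; rewrite !mxE.
Qed.

(** Elements of [S] carrying [q0] within [1 / (k + 1)] of [q] cluster at some element of [K] that
    carries [q0] exactly to [q]; closedness puts it in [S]. *)
Lemma sphere_exact : (0 < n)%N ->
  approximately_controllable (@sphere R n) U H ->
  exactly_controllable (@sphere R n) U H.
Proof.
move=> n0 hap.
have S0 : @sphere R n !=set0 by exists (delta_mx (Ordinal n0) 0); exact: sphere_delta.
have closed := realflow_semigrp_closed hH n0 (sphere_scalar_commutant n0 hap).
apply: (reachable_exact (approx_nonempty S0 hap)) => [w s x _|q0 q hq0 hq].
  exact: sphere_hflow.
have hs k : exists s, semigrp realflow s /\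
    `|realcol q - s *m realcol q0| <= k.+1%:R^-1.
  have k0 : 0 < k.+1%:R^-1 :> R by rewrite invr_gt0.
  have [g Sg hg] := approx_semigrp hap hq0 hq k0; exists (realify g).
  by rewrite -realcolM; split=> //; exact: flow_semigrp_realflow.
have [s hs'] := choice hs.
have sn k : `|s k| <= 1.
  by apply: mx_norm_row; apply: (semigrp_orth (@realflow_orth R n m U H)); have [] := hs' k.
have [k hk] := bounded_mx_cluster sn.
have Kk : semigrp_cl realflow k.
  move=> e e0; have [j _ hj] := hk e 0%N e0; exists (s j); first by have [] := hs' j.
  by rewrite distrC.
have [g Sg eg] := semigrp_realflow (closed _ Kk).
exists g => //; apply: realcol_inj; rewrite realcolM -eg.
apply/eqP; rewrite -subr_eq0; apply/eqP.
apply: (@eq0_le_eps _ _ _ ((n + n)%:R * `|realcol q0| + 1)) => e e0 _.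
have [N hN] : exists N, N.+1%:R^-1 <= e.
  by have [N hN] := ltr_add_invr e0; exists N; move: hN; rewrite add0r => /ltW.
have [j Nj hj] := hk e N e0; have [_ hjq] := hs' j.
have -> : k *m realcol q0 - realcol q =
    - ((s j - k) *m realcol q0) - (realcol q - s j *m realcol q0).
  by rewrite mulmxBl; apply/matrixP => a b; rewrite !mxE; ring.
rewrite (le_trans (ler_normB _ _)) // normrN mulrDl mul1r; apply: lerD.
  by rewrite mulrAC; exact: mx_normMle.
rewrite (le_trans hjq) // (le_trans _ hN) // lef_pV2 ?posrE ?ltr0n //.
by rewrite ler_nat ltnS.
Qed.

Lemma sunitary_sub_grp g : @sunitary_grp R n g -> grp_of U H g.
Proof. by rewrite /grp_of /sunitary_grp /unitary_grp; case: ifP => // _ []. Qed.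

Lemma grp_of_hflow u (t : R) (g : 'M[C]_n) :
  U u -> grp_of U H g -> grp_of U H (hflow (H u) t *m g).
Proof.
move=> Uu; have hg : adjmx g *m g = 1%:M ->
    adjmx (hflow (H u) t *m g) *m (hflow (H u) t *m g) = 1%:M.
  move=> h; rewrite adjmxM -mulmxA (mulmxA (adjmx (hflow _ _))) hflow_unitary.
  by rewrite mul1mx.
rewrite /grp_of; case: ifPn => [/asboolP htr|_]; last exact: hg.
move=> [/hg h1 h2]; split=> //.
by rewrite det_mulmx h2 mulr1 det_hflow ?htr //; exact: hH.
Qed.

Lemma grp_of_div (g h : 'M[C]_n) : grp_of U H g -> grp_of U H h ->
  grp_of U H (g *m adjmx h) /\ adjmx h *m h = 1%:M.
Proof.
have hu : adjmx g *m g = 1%:M -> adjmx h *m h = 1%:M ->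
    adjmx (g *m adjmx h) *m (g *m adjmx h) = 1%:M.
  move=> hg hh; rewrite adjmxM adjmxK -mulmxA (mulmxA (adjmx g)) hg mul1mx.
  exact: mulmx1C.
rewrite /grp_of; case: ifPn => _ /=; last by move=> hg hh; split=> //; exact: hu.
move=> [hg dg] [hh dh]; split=> //; split; first exact: hu.
have := congr1 determinant hh; rewrite det_mulmx dh mulr1 det1 => dh'.
by rewrite det_mulmx dg dh' mulr1.
Qed.
End Controllability.

(** * Controllability on the unitary and special unitary groups *)

Section GroupControllability.
Variables (R : realType) (n m : nat).
Local Notation C := R[i].
Variables (U : set 'rV[R]_m) (H : 'rV[R]_m -> 'M[C]_n).
Hypothesis hH : forall u, U u -> is_hermitian (H u).

Lemma sunitary1 : @sunitary_grp R n 1%:M.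
Proof. by split; [rewrite adjmx1 mul1mx|exact: det1]. Qed.

Lemma adjmx_diag (d : 'rV[C]_n) : adjmx (diag_mx d) = diag_mx (map_mx Num.conj d).
Proof. by rewrite /adjmx map_diag_mx tr_diag_mx. Qed.

Lemma unitary_diag (d : 'rV[C]_n) : (forall k, Num.conj (d 0 k) * d 0 k = 1) ->
  adjmx (diag_mx d) *m diag_mx d = 1%:M.
Proof.
move=> hd; rewrite adjmx_diag mulmx_diag (_ : \row_j _ = const_mx 1) ?diag_const_mx //.
by apply/rowP => k; rewrite !mxE hd.
Qed.

(** Commuting with the diagonal matrix having ['i] and [- 'i] at places [i] and [j] kills the entry
    [X i j]. Commuting with a transposition equates two diagonal entries; one sign is changed so
    that its determinant is 1. *)
Lemma sunitary_commutant (X : 'M[C]_n) :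
  (forall g, @sunitary_grp R n g -> X *m g = g *m X) -> exists c, X = c%:M.
Proof.
move=> hX.
have off i j : i != j -> X i j = 0.
  move=> ij; pose d : 'rV[C]_n := \row_k if k == i then 'i else if k == j then - 'i else 1.
  have /hX/matrixP/(_ i j) : @sunitary_grp R n (diag_mx d).
    split; last first.
      rewrite det_diag (bigD1 i) //= (bigD1 j) 1?eq_sym //= !mxE eqxx.
      rewrite eq_sym (negbTE ij) eqxx big1 => [|k /andP[ki kj]].
        by rewrite mulr1 mulrN -expr2 sqrCi opprK.
      by rewrite mxE (negbTE ki) (negbTE kj).
    apply: unitary_diag => k; rewrite mxE; case: ifP => _.
      by rewrite conjCi mulNr -expr2 sqrCi opprK.
    case: ifP => _; last by rewrite rmorph1 mulr1.
    by rewrite rmorphN /= conjCi opprK mulrN -expr2 sqrCi opprK.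
  rewrite mul_mx_diag mul_diag_mx !mxE eqxx eq_sym (negbTE ij) eqxx => /eqP.
  rewrite mulrN mulrC -subr_eq0 -opprD oppr_eq0 -mulr2n mulrn_eq0 /= mulf_eq0.
  by rewrite (negbTE (neq0Ci _)) /= => /eqP.
have diag i j : i != j -> X i i = X j j.
  move=> ij; pose d : 'rV[C]_n := \row_k if k == i then -1 else 1.
  pose g := diag_mx d *m perm_mx (tperm i j).
  have gij : g i j = -1.
    by rewrite /g mul_diag_mx !mxE eqxx tpermL eqxx mulr1.
  have /hX/matrixP/(_ i j) : @sunitary_grp R n g.
    split; last first.
      rewrite /g det_mulmx det_diag det_perm odd_tperm ij (bigD1 i) //= mxE eqxx.
      rewrite big1 => [|k ki]; last by rewrite mxE (negbTE ki).
      by rewrite mulr1 expr1 mulrN1 opprK.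
    rewrite /g adjmxM -mulmxA (mulmxA (adjmx (diag_mx d))) unitary_diag ?mul1mx.
      by rewrite /adjmx map_perm_mx tr_perm_mx -perm_mxM mulVg perm_mx1.
    by move=> k; rewrite mxE; case: ifP => _; rewrite ?rmorphN rmorph1 ?mulr1 // mulrNN mulr1.
  rewrite mxE (bigD1 i) //= big1 => [|k ki]; last by rewrite off ?mul0r // eq_sym.
  rewrite [(g *m X) i j]mxE (bigD1 j) //= big1 => [|k kj]; last by rewrite off ?mulr0.
  by rewrite gij !addr0 mulrN1 mulN1r => /oppr_inj.
have [i0|hn] := boolP (0 < n)%N.
  exists (X (Ordinal i0) (Ordinal i0)); apply/matrixP => i j; rewrite mxE.
  have [<-|ij] := eqVneq i j; last by rewrite off.
  rewrite mulr1n; have [->//|h] := eqVneq i (Ordinal i0).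
  exact: diag.
exists 0; apply/matrixP => i; by case: (i) => k hk; exfalso; move: hn; rewrite (leq_ltn_trans _ hk).
Qed.

(** Both possible groups contain the special unitary group, and the semigroup orbit of the identity
    approximates every element of it; its commutant therefore suffices in either case. *)
Lemma grp_scalar_commutant :
  approximately_controllable (grp_of U H) U H -> scalar_commutant U H.
Proof.
move=> hap X _ hX; apply: sunitary_commutant => q /(sunitary_sub_grp U H) Gq.
have G1 := sunitary_sub_grp U H sunitary1.
apply/esym/realify_inj; rewrite !realifyM; apply: comm_mx_closed => e e0.
have [g Sg hg] := approx_semigrp hH hap G1 Gq e0.
exists (realify g); last by rewrite -!realifyM (flow_semigrp_commute hH hX Sg).
rewrite -realifyB (le_trans (realify_norm _)) // realcolB.
by rewrite mulmx1 in hg.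
Qed.

Lemma grp_exact : (0 < n)%N ->
  approximately_controllable (grp_of U H) U H ->
  exactly_controllable (grp_of U H) U H.
Proof.
move=> n0 hap; have G1 := sunitary_sub_grp U H sunitary1.
have closed := realflow_semigrp_closed hH n0 (grp_scalar_commutant hap).
have S0 : grp_of U H !=set0 by exists 1%:M.
apply: (reachable_exact hH (approx_nonempty S0 hap)) => [w s x|q0 q hq0 hq].
  exact: grp_of_hflow.
have [hd hu] := grp_of_div hq hq0.
have Kd : semigrp_cl (@realflow R n m U H) (realify (q *m adjmx q0)).
  move=> e e0; have [g Sg hg] := approx_semigrp hH hap G1 hd e0.
  exists (realify g); first exact: flow_semigrp_realflow.
  rewrite -realifyB (le_trans (realify_norm _)) // realcolB.
  by rewrite mulmx1 in hg.
have [g Sg /realify_inj eg] := semigrp_realflow (closed _ Kd).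
by exists g => //; rewrite -eg -mulmxA hu mulmx1.
Qed.
End GroupControllability.

Theorem theorem4p1 (R : realType) (n m : nat) (U : set 'rV[R]_m)
  (H : 'rV[R]_m -> 'M[R[i]]_n) :
  (2 <= n)%N ->
  (forall u, U u -> is_hermitian (H u)) ->
  smooth_on U H ->
  (approximately_controllable (@sphere R n) U H <->
   exactly_controllable (@sphere R n) U H) /\
  (approximately_controllable (grp_of U H) U H <->
   exactly_controllable (grp_of U H) U H).
Proof.
move=> /ltnW n0 hH _; split; split; try exact: exact_approx.
  exact: sphere_exact.
exact: grp_exact.
Qed.
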